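(* Let $\cong$ be a congruence on LTSs such that $L\doteq L'$ implies $L\cong L'$ and $V\cong B$. Then: (1) if $\cong$ preserves $\mathit{snF}$ but preserves neither $\mathit{anF}$ nor $\mathit{aenI}$, then $\cong$ is the equivalence induced by $\Sigma,\mathit{snF},\mathit{Div},\mathit{eanI}$; (2) if $\cong$ preserves $\mathit{snF}$ and $\mathit{aenI}$ but preserves neither $\mathit{anF}$ nor $\mathit{Inf}$, then $\cong$ is the equivalence induced by $\Sigma,\mathit{snF},\mathit{Div},\mathit{aenI}$; (3) if $\cong$ preserves $\mathit{snF}$ and $\mathit{Inf}$ but does not preserve $\mathit{anF}$, then $\cong$ is the equivalence induced by $\Sigma,\mathit{snF},\mathit{Div},\mathit{Inf}$.
   Context: An LTS is a tuple $L=(S,\Sigma,\Delta,\hat s)$ with states $S$, alphabet $\Sigma$ (possibly infinite), $\tau\notin\Sigma$ a reserved invisible action, transitions $\Delta\subseteq S\times(\Sigma\cup\{\tau\})\times S$, initial state $\hat s$; $\Sigma(L)$ denotes the alphabet. Operators: action prefix $a.L$ ($a\neq\tau$): new initial state $\hat s'$, alphabet $\Sigma\cup\{a\}$, transitions $\Delta\cup\{(\hat s',a,\hat s)\}$. Hiding $L\setminus A$: alphabet $\Sigma\setminus A$, each transition labelled by an element of $A$ relabelled $\tau$, otherwise unchanged. Relational renaming $L\Phi$ ($\Phi$ a set of pairs, $\tau$ not in its domain $\mathcal D(\Phi)$ or range; $\Phi(a,b)$ means $(a,b)\in\Phi$ or $a=b\notin\mathcal D(\Phi)$): alphabet $\{b\mid\exists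 a\in\Sigma:\Phi(a,b)\}$, transitions $\{(s,b,s')\mid\exists a:(s,a,s')\in\Delta\wedge\Phi(a,b)\}$, same states and initial state. Parallel composition $L_1\|L_2$: states $S_1\times S_2$, alphabet $\Sigma_1\cup\Sigma_2$, initial $(\hat s_1,\hat s_2)$; actions in $\Sigma_1\cap\Sigma_2$ are taken jointly by both components, all other actions (including $\tau$) by one component while the other stays put. A congruence is an equivalence $\cong$ with $L\cong L'\Rightarrow a.L\cong a.L',\ L\setminus A\cong L'\setminus A,\ L\Phi\cong L'\Phi,\ L\|L''\cong L'\|L'',\ L''\|L\cong L''\|L'$. For $\sigma=a_1\cdots a_n\in\Sigma^*$, $s\stackrel{\sigma}{\Rightarrow}s'$ means a finite path from $s$ to $s'$ whose non-$\tau$ labels are exactly $a_1,\dots,a_n$ in order; $\hat s\stackrel{\xi}{\Rightarrow}$ for $\xi\in\Sigma^\omega$ means an infinite path from $\hat s$ whose non-$\tau$ label sequence is $\xi$; $s\stackrel{\tau^\omega}{\to}$ means an infinite path of $\tau$-transitions from $s$. Define $\mathit{Tr}(L)=\{\sigma\in\Sigma^*\mid\exists s:\hat s\stackrel\sigma\Rightarrow s\}$, $\mathit{Div}(L)=\{\sigma\in\Sigma^*\mid\exists s:\hat s\stackrel\sigma\Rightarrow s\wedge s\stackrel{\tau^\omega}\to\}$, $\mathit{Inf}(L)=\{\xi\in\Sigma^\omega\mid\hat s\stackrel\xi\Rightarrow\}$, $\mathit{Sf}(L)=\{(\sigma,A)\in\Sigma^*\times2^\Sigma\mid\exists s:\hat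 s\stackrel\sigma\Rightarrow s\wedge\forall a\in A\cup\{\tau\}\,\forall s':(s,a,s')\notin\Delta\}$. Further: $\mathit{minD}(L)=\{a_1\cdots a_n\in\mathit{Div}(L)\mid\forall i,0\le i<n: a_1\cdots a_i\notin\mathit{Div}(L)\}$; $\mathit{extT}(L)=\{a_1\cdots a_n\in\Sigma(L)^*\mid\exists i,0\le i\le n: a_1\cdots a_i\in\mathit{minD}(L)\}$; $\mathit{eanI}(L)=\{a_1a_2\cdots\in\mathit{Inf}(L)\mid\exists n\ge0\,\forall i\ge n: a_1\cdots a_i\notin\mathit{Div}(L)\}$; $\mathit{aenI}(L)=\{a_1a_2\cdots\in\mathit{Inf}(L)\mid\forall n\ge0\,\exists i\ge n: a_1\cdots a_i\notin\mathit{Div}(L)\}$; $\mathit{nF}(L)=\{(\sigma,A)\in\mathit{Sf}(L)\mid\sigma\notin\mathit{Div}(L)\}$; $\mathit{snF}(L)=\{(\sigma,A)\in\mathit{nF}(L)\mid\forall a\in A:\sigma a\notin\mathit{Div}(L)\}$; $\mathit{anF}(L)=\{(\sigma,A)\in\mathit{Sf}(L)\mid\sigma\notin\mathit{extT}(L)\}$. $L\doteq L'$ (CFFD-equivalence) iff $\Sigma,\mathit{Sf},\mathit{Div},\mathit{Inf}$ all agree on $L$ and $L'$. An equivalence preserves $X$ if $L\cong L'\Rightarrow X(L)=X(L')$; the equivalence induced by $\Sigma,X_1,\dots,X_k$ relates $L,L'$ iff all these functions agree on them. $V$ is the one-state LTS with empty alphabet and a single $\tau$ self-loop; $B$ is the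 LTS with empty alphabet, states $s_0$ (initial) and $s_1$, and transitions $(s_0,\tau,s_0)$, $(s_0,\tau,s_1)$. *)

(* Defs.v *)
From mathcomp Require Import all_boot all_classical.
Set Implicit Arguments.
Unset Strict Implicit.
Unset Printing Implicit Defensive.
Local Open Scope classical_set_scope.

(* [Act] is the universe of visible actions from
   which all alphabets are drawn; a transition label is an element of
   [option Act], and [None] is the invisible action tau (so tau is never in an
   alphabet). *)
Record LTS (Act : Type) : Type := MkLTS {
  state : Type;
  alphabet : set Act;
  trans : state -> option Act -> state -> Prop;
  init : state;
  transP : forall s a s', trans s (Some a) s' -> alphabet a }.

Section Operators.
Variable Act : Type.
Implicit Types (L : LTS Act) (a : Act) (A : set Act) (Phi : set (Act * Act)).

(* The new initial state is [None]. *)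
Definition pref_trans a L (s : option (state L)) (l : option Act)
    (s' : option (state L)) : Prop :=
  match s, s' with
  | None, Some t => l = Some a /\ t = init L
  | Some t, Some t' => trans t l t'
  | _, None => False
  end.

Lemma pref_transP a L s b s' :
  @pref_trans a L s (Some b) s' -> (alphabet L `|` [set a]) b.
Proof.
case: s s' => [s|] [s'|] //= => [h|[[->] _]]; last by right.
by left; exact: transP h.
Qed.

Definition pref a L : LTS Act := MkLTS None (@pref_transP a L).

Definition hiding_trans L A (s : state L) (l : option Act) (s' : state L) : Prop :=
  match l with
  | Some a => trans s (Some a) s' /\ ~ A a
  | None => trans s None s' \/ exists2 a, A a & trans s (Some a) s'
  end.

Lemma hiding_transP L A s a s' :
  @hiding_trans L A s (Some a) s' -> (alphabet L `\` A) a.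
Proof. by case=> h nAa; split=> //; exact: transP h. Qed.

Definition hiding L A : LTS Act := MkLTS (init L) (@hiding_transP L A).

Definition renames Phi a b : Prop :=
  Phi (a, b) \/ a = b /\ ~ exists c, Phi (a, c).

Definition renaming_trans L Phi (s : state L) (l : option Act) (s' : state L) :
    Prop :=
  match l with
  | Some b => exists a, trans s (Some a) s' /\ renames Phi a b
  | None => trans s None s'
  end.

Lemma renaming_transP L Phi s b s' :
  @renaming_trans L Phi s (Some b) s' ->
  [set b | exists a, alphabet L a /\ renames Phi a b] b.
Proof. by case=> a [h ab]; exists a; split=> //; exact: transP h. Qed.

Definition renaming L Phi : LTS Act := MkLTS (init L) (@renaming_transP L Phi).

Definition synchronised L1 L2 (l : option Act) : Prop :=
  if l is Some a then (alphabet L1 `&` alphabet L2) a else False.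

Definition par_trans L1 L2 (s : state L1 * state L2) (l : option Act)
    (s' : state L1 * state L2) : Prop :=
  [\/ [/\ synchronised L1 L2 l, trans s.1 l s'.1 & trans s.2 l s'.2],
      [/\ ~ synchronised L1 L2 l, trans s.1 l s'.1 & s.2 = s'.2]
    | [/\ ~ synchronised L1 L2 l, s.1 = s'.1 & trans s.2 l s'.2]].

Lemma par_transP L1 L2 s a s' :
  @par_trans L1 L2 s (Some a) s' -> (alphabet L1 `|` alphabet L2) a.
Proof.
by case=> [[_ h _]|[_ h _]|[_ _ h]]; [left|left|right]; exact: transP h.
Qed.

Definition par L1 L2 : LTS Act := MkLTS (init L1, init L2) (@par_transP L1 L2).

Record congruence (R : LTS Act -> LTS Act -> Prop) : Prop := MkCongruence {
  congr_refl : forall L, R L L;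
  congr_sym : forall L L', R L L' -> R L' L;
  congr_trans : forall L L' L'', R L L' -> R L' L'' -> R L L'';
  congr_pref : forall a L L', R L L' -> R (pref a L) (pref a L');
  congr_hiding : forall A L L', R L L' -> R (hiding L A) (hiding L' A);
  congr_renaming : forall Phi L L', R L L' -> R (renaming L Phi) (renaming L' Phi);
  congr_parl : forall L'' L L', R L L' -> R (par L L'') (par L' L'');
  congr_parr : forall L'' L L', R L L' -> R (par L'' L) (par L'' L') }.

Definition V_trans (s : unit) (l : option Act) (s' : unit) : Prop := l = None.

Lemma V_transP s a s' : V_trans s (Some a) s' -> (@set0 Act) a.
Proof. by []. Qed.

Definition V : LTS Act := MkLTS tt V_transP.

(* [false] is s_0 and [true] is s_1. *)
Definition B_trans (s : bool) (l : option Act) (s' : bool) : Prop :=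
  s = false /\ l = None.

Lemma B_transP s a s' : B_trans s (Some a) s' -> (@set0 Act) a.
Proof. by case. Qed.

Definition B : LTS Act := MkLTS false B_transP.

End Operators.

Section Semantics.
Variables (Act : Type) (L : LTS Act).
Implicit Types (s t u : state L) (sigma : seq Act) (xi : nat -> Act).

Inductive weak_path : state L -> seq Act -> state L -> Prop :=
  | weak_nil s : weak_path s [::] s
  | weak_tau s t u sigma :
      trans s None t -> weak_path t sigma u -> weak_path s sigma u
  | weak_vis s t u a sigma :
      trans s (Some a) t -> weak_path t sigma u -> weak_path s (a :: sigma) u.

(* [k] enumerates in increasing order the positions of the non-tau labels of
   the infinite path [p 0 -l 0-> p 1 -l 1-> p 2 ...]. *)
Definition weak_inf_path s xi : Prop :=
  exists (p : nat -> state L) (l : nat -> option Act) (k : nat -> nat),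
  [/\ p 0 = s,
      forall n, trans (p n) (l n) (p n.+1),
      forall i, k i < k i.+1,
      forall i, l (k i) = Some (xi i)
    & forall n, l n <> None -> exists i, n = k i].

Definition diverges s : Prop :=
  exists p : nat -> state L, p 0 = s /\ forall n, trans (p n) None (p n.+1).

Definition Div : set (seq Act) :=
  [set sigma | exists s, weak_path (init L) sigma s /\ diverges s].

Definition Inf : set (nat -> Act) := [set xi | weak_inf_path (init L) xi].

Definition Sf : set (seq Act * set Act) :=
  [set f | f.2 `<=` alphabet L /\
    exists s, [/\ weak_path (init L) f.1 s,
                  forall a, f.2 a -> forall s', ~ trans s (Some a) s'
                & forall s', ~ trans s None s']].

Definition minD : set (seq Act) :=
  [set sigma | Div sigma /\ forall i, i < size sigma -> ~ Div (take i sigma)].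

Definition extT : set (seq Act) :=
  [set sigma | all (mem (alphabet L)) sigma /\
    exists2 i, i <= size sigma & minD (take i sigma)].

(* [mkseq xi i] is the prefix of [xi] of length [i]. *)
Definition eanI : set (nat -> Act) :=
  [set xi | Inf xi /\ exists n, forall i, n <= i -> ~ Div (mkseq xi i)].

Definition aenI : set (nat -> Act) :=
  [set xi | Inf xi /\ forall n, exists2 i, n <= i & ~ Div (mkseq xi i)].

Definition nF : set (seq Act * set Act) := [set f | Sf f /\ ~ Div f.1].

Definition snF : set (seq Act * set Act) :=
  [set f | nF f /\ forall a, f.2 a -> ~ Div (rcons f.1 a)].

Definition anF : set (seq Act * set Act) := [set f | Sf f /\ ~ extT f.1].

End Semantics.

Definition CFFD (Act : Type) (L L' : LTS Act) : Prop :=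
  [/\ alphabet L = alphabet L', Sf L = Sf L', Div L = Div L' & Inf L = Inf L'].

Definition preserves (Act T : Type) (R : LTS Act -> LTS Act -> Prop)
    (X : LTS Act -> T) : Prop :=
  forall L L', R L L' -> X L = X L'.

Definition induced_by (Act T1 T2 T3 : Type) (R : LTS Act -> LTS Act -> Prop)
    (X1 : LTS Act -> T1) (X2 : LTS Act -> T2) (X3 : LTS Act -> T3) : Prop :=
  forall L L', R L L' <->
    [/\ alphabet L = alphabet L', X1 L = X1 L', X2 L = X2 L' & X3 L = X3 L'].

(* Main.v *)
(** A controller running in parallel with a system M, synchronising on renamed copies of the actions of M which are
    then hidden, turns M into a context C[M], so that M ~ M' gives C[M] ~ C[M'].

    Preserving snF forces preserving Div: a controller that makes M perform sigma
    before showing v has a stable failure at v unless sigma is a divergence of M.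
    Preserving Div in turn forces preserving eanI, since an infinite trace whose
    prefixes eventually do not diverge becomes a divergence when its tail is hidden.

    Conversely, every witness M ~ M' of non-preservation is turned into a context
    that behaves like L on M' but like L with additional semantics on M. The pair
    V, B adds all stable failures at divergent traces; a witness against anF adds
    to every refusal all actions leading to divergent traces; a witness against
    aenI or Inf adds all infinite traces having infinitely many, respectively
    almost only, divergent prefixes. After these additions the CFFD semantics of L
    is a function of its alphabet, snF, Div and eanI, aenI or Inf. *)
Require Import Defs.
From mathcomp Require Import all_boot all_classical.
Set Implicit Arguments.
Unset Strict Implicit.
Unset Printing Implicit Defensive.
Local Open Scope classical_set_scope.

(** * Weak paths *)

(** The alphabets of L and M may exhaust [Act], so a context has no fresh letters at hand. An
    injection of [Act * nat] into [Act], which exists because [Act] is infinite, supplies tagged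
    copies of all letters. The obstacle in building the contexts is that the controlled system leaks
    its own divergences, refusals and infinite traces. With M' inside, exactly the CFFD semantics of
    L must come out. So M' may diverge only after traces at which L diverges already, control
    returns to L only while the word performed by M' is nondivergent, and a stable extra state must
    either refuse no more than L does or occur at a divergent trace of L. The last alternative is
    harmless only if L already has all stable failures at its divergent traces; hence the addition
    based on V and B has to precede the others. A witness that might diverge at once is prefixed
    with a visible letter, which makes its empty trace nondivergent. *)

Lemma infinite_absorbs_nat (T : Type) :
  infinite_set [set: T] -> exists f : T * nat -> T, injective f.
Proof.
move=> Tinf.
(* A maximal disjoint family of ranges of injective sequences misses only a finite set [rest]. A
   point is coded by its index in its own sequence or, if in [rest], by a number attached to [e0];
   the code paired with [m] is the index of the image of [(x, m)] on the same sequence. *)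
pose injs := [set e : nat -> T | injective e].
have [E [EI Edisj Emax]] := ex_maximal_disjoint_subcollection
  (fun e : nat -> T => range e) injs.
pose rest := ~` \bigcup_(e in E) range e.
have restfin : finite_set rest.
  apply: contrapT => /infiniteP/card_leP[h'].
  pose h (i : nat) : T := val (h' (SigSub (mem_setT i))).
  have hinj : injective h.
    by move=> i j /val_inj /inj; rewrite !inE => /(_ I I) [].
  have hrest i : rest (h i) by apply: set_mem; exact: valP.
  have nEh : ~ E h by move=> Eh; apply: (hrest 0); exists h => //; exists 0.
  apply: (Emax (E `|` [set (h : nat -> T)])).
  - by split; [left|move=> /(_ h) H; apply/nEh/H; right].
  - by move=> e [/EI//|->].
  move=> e e' [Ee|->] [Ee'|->] [x []]; first by move=> ex e'x; apply: Edisj => //; exists x.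
  - by move=> [i _ <-] [j _ hji]; case: (hrest j); rewrite hji; exists e => //; exists i.
  - by move=> [j _ <-] [i _ hji]; case: (hrest j); rewrite -hji; exists e' => //; exists i.
  - by [].
have [e0 E0] : exists e, E e.
  apply: contrapT => nE; apply/Tinf/(sub_finite_set _ restfin) => x _ [e Ee _].
  by apply: nE; exists e.
have /countable_injP[g ginj] := finite_set_countable restfin.
have /choice[c cP] : forall x, exists y : (nat -> T) * (nat + nat),
    E y.1 /\
    match y.2 with inl i => y.1 i = x | inr i => [/\ y.1 = e0, rest x & g x = i] end.
  move=> x; have [xr|] := pselect (rest x); first by exists (e0, inr (g x)).
  by move=> /contrapT[e Ee [i _ <-]]; exists (e, inl i).
exists (fun p => (c p.1).1 (pickle ((c p.1).2, p.2))) => -[x m] [y n] /= exy.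
have e12 : (c x).1 = (c y).1.
  apply: (Edisj _ _ (cP x).1 (cP y).1).
  exists ((c x).1 (pickle ((c x).2, m))).
  by split; [|rewrite exy]; eexists.
have [Ex cx] := cP x; have [_ cy] := cP y.
move: exy; rewrite -e12 => /(EI _ Ex)/(pcan_inj pickleK)[c2 <-]; congr (_, _).
move: cx cy; rewrite -c2 -e12; case: (c x).2 => i; first by move=> ex ey; exact: etrans (esym ex) ey.
by move=> [_ rx gx] [_ ry gy]; apply: ginj; [exact: mem_set|exact: mem_set|rewrite gx gy].
Qed.

Lemma LTS_ext Act (S : Type) (A1 A2 : set Act) (t1 t2 : S -> option Act -> S -> Prop)
    (i : S) p1 p2 :
  A1 = A2 -> (forall s l s', t1 s l s' <-> t2 s l s') ->
  @MkLTS Act S A1 t1 i p1 = @MkLTS Act S A2 t2 i p2.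
Proof.
move=> eA et; have {}et : t1 = t2.
  by apply/funext => s; apply/funext => l; apply/funext => s'; apply/propext.
by subst; congr MkLTS; apply: Prop_irrelevance.
Qed.

Definition label_word (Act : Type) (l : option Act) : seq Act :=
  if l is Some a then [:: a] else [::].

Section Paths.
Variables (Act : Type) (L : LTS Act).
Implicit Types (s t u : state L) (sigma : seq Act) (xi : nat -> Act).

Lemma weak_step s l t : trans s l t -> weak_path s (label_word l) t.
Proof.
by case: l => [a|] st /=; [apply: weak_vis st _|apply: weak_tau st _]; apply: weak_nil.
Qed.

Lemma weak_cat s t u sigma tau :
  weak_path s sigma t -> weak_path t tau u -> weak_path s (sigma ++ tau) u.
Proof.
move=> st; elim: st tau u => //.
  by move=> {}s {}t v sg st _ IH tau u /IH; apply: weak_tau.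
by move=> {}s {}t v a sg st _ IH tau u /IH; apply: weak_vis.
Qed.

Lemma weak_rcons s t u sigma l :
  weak_path s sigma t -> trans t l u -> weak_path s (sigma ++ label_word l) u.
Proof. by move=> st /weak_step; apply: weak_cat. Qed.

Lemma weak_split s u sigma tau :
  weak_path s (sigma ++ tau) u ->
  exists2 t, weak_path s sigma t & weak_path t tau u.
Proof.
move E : (sigma ++ tau) => w su; elim: su sigma E.
- by move=> {}s [|//] /= ->; exists s; apply: weak_nil.
- move=> {}s t v sg st _ IH sigma /IH[r tr rv]; exists r => //.
  exact: weak_tau st tr.
move=> {}s t v a sg st tv IH [/= ->|b sigma /= [-> E]].
  by exists s; [apply: weak_nil|apply: weak_vis st tv].
by have [r tr rv] := IH _ E; exists r => //; apply: weak_vis st tr.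
Qed.

Lemma diverges_coind (P : state L -> Prop) s :
  P s -> (forall t, P t -> exists2 u, trans t None u & P u) -> diverges s.
Proof.
move=> Ps step.
have /choice[f fP] : forall x : {t | P t}, exists y : {t | P t},
    trans (sval x) None (sval y).
  by case=> t Pt; have [u tu Pu] := step t Pt; exists (exist _ u Pu).
exists (fun n => sval (iter n f (exist _ s Ps))); split=> [|n] //=; exact: fP.
Qed.

Lemma diverges_step s : diverges s -> exists2 t, trans s None t & diverges t.
Proof.
move=> [p [<- pP]]; exists (p 1); first exact: pP.
by exists (fun n => p n.+1); split.
Qed.

Lemma step_diverges s t : trans s None t -> diverges t -> diverges s.
Proof.
move=> st [p [p0 pP]]; exists (fun n => if n is m.+1 then p m else s); split=> //.
by case=> //=; rewrite p0.
Qed.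

Lemma weak_diverges s t : weak_path s [::] t -> diverges t -> diverges s.
Proof.
by move E : [::] => w st; elim: st E => // {}s {}t u sg st _ IH /IH/[apply]; apply: step_diverges.
Qed.

Lemma nondiverges_stable s : ~ diverges s ->
  exists2 t, weak_path s [::] t & forall u, ~ trans t None u.
Proof.
move=> nd; apply: contrapT => H; apply: nd.
apply: (@diverges_coind (fun t => weak_path s [::] t)); first exact: weak_nil.
move=> t st; apply: contrapT => nt; apply: H; exists t => // u tu; apply: nt.
by exists u => //; apply: (weak_rcons (l := None) st).
Qed.

End Paths.

Section InfinitePaths.
Variables (Act : Type) (L : LTS Act).
Implicit Types (s t u : state L) (sigma : seq Act) (xi : nat -> Act).

Lemma weak_inf_path_steps s xi : weak_inf_path s xi ->
  exists2 q : nat -> state L, q 0 = s & forall i, weak_path (q i) [:: xi i] (q i.+1).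
Proof.
move=> [p [l [k [p0 pP kS kl klP]]]].
have kltn i j : i < j -> k i < k j.
  exact: (homo_ltn ltn_trans kS).
pose m i := if i is j.+1 then (k j).+1 else 0.
have mk i : m i <= k i by case: i => //= i; apply: kS.
exists (p \o m) => //= i.
suff H d : forall n, k i - n = d -> m i <= n -> n <= k i ->
    weak_path (p n) [:: xi i] (p (k i).+1) by apply: H (mk i).
elim: d => [|d IH] n.
  move/eqP; rewrite subn_eq0 => kn _ nk; have -> : n = k i by apply/anti_leq/andP.
  by apply: (weak_step (l := Some (xi i))); rewrite -kl.
move=> dn mn nk; have nltk : n < k i by rewrite -subn_gt0 dn.
have ln : l n = None.
  apply: contrapT => /klP[j nj]; move: mn nltk; rewrite nj.
  case: (ltngtP i j) => [/kltn||->]; last by rewrite ltnn.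
    by move=> /ltnW ij _; rewrite ltnNge ij.
  case: i {IH dn nk mk} => //= i; rewrite ltnS leq_eqVlt => /orP[/eqP->|/kltn].
    by rewrite ltnn.
  by rewrite ltnNge => /negbTE+ ki; rewrite ltnW.
apply: (@weak_tau _ _ _ (p n.+1)); first by rewrite -ln.
apply: IH => //; last exact: leqW.
by rewrite subnS dn.
Qed.

(* [P s i n] says that a path whose visible labels are [xi i, xi i.+1, ...]
   starts in [s] and performs its first visible step after [n] tau-steps. *)
Lemma ranked_weak_inf_path (P : state L -> nat -> nat -> Prop) s xi n :
  P s 0 n ->
  (forall t i r, P t i r.+1 -> exists2 u, trans t None u & P u i r) ->
  (forall t i, P t i 0 -> exists2 u, trans t (Some (xi i)) u & exists r, P u i.+1 r) ->
  weak_inf_path s xi.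
Proof.
move=> Ps Ptau Pvis.
pose T := {x : state L * nat * nat | P x.1.1 x.1.2 x.2}.
pose lab (x : state L * nat * nat) := if x.2 is 0 then Some (xi x.1.2) else None.
pose idx (x : state L * nat * nat) := if x.2 is 0 then x.1.2.+1 else x.1.2.
have /choice[f fP] : forall x : T, exists y : T,
    [/\ trans (sval x).1.1 (lab (sval x)) (sval y).1.1,
        (sval y).1.2 = idx (sval x) &
        forall r, (sval x).2 = r.+1 -> (sval y).2 = r].
  case=> -[[t i] [|r]] /= Pt.
    by have [u tu [r Pu]] := Pvis _ _ Pt; exists (exist _ (u, i.+1, r) Pu).
  have [u tu Pu] := Ptau _ _ _ Pt; exists (exist _ (u, i, r) Pu); split=> //.
  by move=> r' /= e; case: e => ->.
pose x m := sval (iter m f (exist _ (s, 0, n) Ps)).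
have xP m : [/\ trans (x m).1.1 (lab (x m)) (x m.+1).1.1,
    (x m.+1).1.2 = idx (x m) & forall r, (x m).2 = r.+1 -> (x m.+1).2 = r].
  exact: fP.
have descend r : forall m, (x m).2 = r -> exists2 m', (x m').2 = 0 & (x m').1.2 = (x m).1.2.
  elim: r => [|r IH] m xm; first by exists m.
  have [_ xi' /(_ _ xm) /IH[m' m'0 e]] := xP m; exists m' => //.
  by rewrite e xi' /idx xm.
have /choice[k kP] : forall i, exists m, (x m).2 = 0 /\ (x m).1.2 = i.
  elim=> [|i [m [m0 mi]]].
    by have [m m0 mi] := descend _ 0 erefl; exists m.
  have [_ e _] := xP m; have [m' m'0 m'i] := descend _ m.+1 erefl.
  by exists m'; rewrite m'i e /idx m0 mi.
have idxS m : (x m).1.2 <= (x m.+1).1.2.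
  by have [_ -> _] := xP m; rewrite /idx; case: (x m).2.
have idx_mono : {homo (fun m => (x m).1.2) : m m' / m <= m'}.
  exact: (homo_leq leqnn leq_trans idxS).
have idx_lt m m' : (x m).2 = 0 -> m < m' -> (x m).1.2 < (x m').1.2.
  move=> m0 mm'; have [_ e _] := xP m.
  by apply: leq_trans (idx_mono _ _ mm'); rewrite e /idx m0.
exists (fun m => (x m).1.1), (fun m => lab (x m)), k; split=> //.
- by move=> m; have [] := xP m.
- move=> i; rewrite ltnNge; apply/negP => /idx_mono.
  by rewrite (kP i).2 (kP i.+1).2 ltnn.
- by move=> i; rewrite /lab (kP i).1 (kP i).2.
move=> m; rewrite /lab; case m0 : (x m).2 => // _; exists (x m).1.2.
have [k0 ki] := kP (x m).1.2.
case: (ltngtP m (k (x m).1.2)) => // [/(idx_lt _ _ m0)|/(idx_lt _ _ k0)].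
  by rewrite ki ltnn.
by rewrite ki ltnn.
Qed.

(** Each weak step is cut at its visible transition: [Q t i n] fixes the [n] tau-steps before it,
    and [pre] moves the tau-steps after it to the front of the next weak step. The number [n] is the
    rank. *)
Lemma weak_inf_path_coind (P : state L -> nat -> Prop) s xi :
  P s 0 ->
  (forall t i, P t i -> exists2 u, weak_path t [:: xi i] u & P u i.+1) ->
  weak_inf_path s xi.
Proof.
move=> Ps step.
pose Q t i n := exists (c : nat -> state L) u,
  [/\ c 0 = t, forall m, m < n -> trans (c m) None (c m.+1),
      trans (c n) (Some (xi i)) u & exists2 v, weak_path u [::] v & P v i.+1].
have toQ t i : P t i -> exists n, Q t i n.
  move=> /step[v tv Pv]; move E : [:: xi i] tv => w tv.
  elim: tv E Pv => // [{}t t' u sg tt' _ IH E Pu|{}t t' u a sg tt' t'u IH [Ea Es] Pu].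
    have [n [c [u' [c0 cn cu h]]]] := IH E Pu.
    exists n.+1, (fun m => if m is m'.+1 then c m' else t), u'; split=> //.
    by case=> [_|m]; [rewrite c0|exact: cn].
  exists 0, (fun=> t), t'; split=> //; first by rewrite Ea.
  by exists u => //; rewrite Es.
have pre t u i : weak_path t [::] u -> (exists n, Q u i n) -> exists n, Q t i n.
  move E : [::] => w tu; elim: tu E => // {}t t' u' sg tt' _ IH E Qu.
  have [n [c [v [c0 cn cv h]]]] := IH E Qu.
  exists n.+1, (fun m => if m is m'.+1 then c m' else t), v; split=> //.
  by case=> [_|m]; [rewrite c0|exact: cn].
have [n Qn] := toQ _ _ Ps.
apply: (ranked_weak_inf_path (P := Q) Qn).
  move=> t i r [c [u [c0 cn cu h]]]; exists (c 1); first by rewrite -c0; apply: cn.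
  by exists (fun m => c m.+1), u; split=> // m mr; apply: cn.
move=> t i [c [u [c0 _ cu [v uv Pv]]]]; exists u; first by rewrite -c0.
exact: pre uv (toQ _ _ Pv).
Qed.

Lemma weak_inf_path_steps_rev (q : nat -> state L) xi :
  (forall i, weak_path (q i) [:: xi i] (q i.+1)) -> weak_inf_path (q 0) xi.
Proof.
move=> qP; apply: (weak_inf_path_coind (P := fun u i => u = q i)) => // t i ->.
by exists (q i.+1).
Qed.

Lemma weak_inf_path_prefix s t xi n :
  weak_path s (mkseq xi n) t -> weak_inf_path t (fun i => xi (n + i)) ->
  weak_inf_path s xi.
Proof.
elim: n xi s => [|n IH] xi s.
  move=> st /weak_inf_path_steps[q q0 qP].
  apply: (weak_inf_path_coind (P := fun u i => u = if i is 0 then s else q i)) => // u i ->.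
  exists (q i.+1) => //; case: i => [|i]; last exact: qP.
  by apply: (weak_cat (sigma := [::]) st); rewrite -q0; apply: qP.
rewrite /mkseq /= (iotaDl 1 0) -map_comp -cat1s => /weak_split[u su ut] tinf.
have /weak_inf_path_steps[q q0 qP] := IH (fun i => xi i.+1) u ut tinf.
pose q' i := if i is j.+1 then q j else s.
apply: (weak_inf_path_steps_rev (q := q')) => -[|i] /=; last exact: qP.
by rewrite q0.
Qed.

End InfinitePaths.

(** * Controlled systems as contexts *)

(** [ctrl_step] is a move of the controller alone. [ctrl_hide q a] accompanies the action [a] of the
    system and is invisible. [ctrl_joint q b] is seen as [b] and accompanies an action from a set
    [U], without knowing which one. *)
Record controller (Act : Type) := Controller {
  ctrl : Type;
  ctrl_init : ctrl;
  ctrl_step : ctrl -> option Act -> ctrl -> Prop;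
  ctrl_hide : ctrl -> Act -> ctrl -> Prop;
  ctrl_joint : ctrl -> Act -> ctrl -> Prop }.

Section Controlled.
Variables (Act : Type) (A U : set Act) (K : controller Act) (M : LTS Act).

Definition controlled_trans (p : state M * ctrl K) (l : option Act)
    (p' : state M * ctrl K) : Prop :=
  match l with
  | Some b => A b /\
      (p.1 = p'.1 /\ ctrl_step p.2 (Some b) p'.2 \/
       exists a, [/\ U a, trans p.1 (Some a) p'.1 & ctrl_joint p.2 b p'.2])
  | None =>
      [\/ trans p.1 None p'.1 /\ p.2 = p'.2,
          p.1 = p'.1 /\ ctrl_step p.2 None p'.2
        | exists2 a, trans p.1 (Some a) p'.1 & ctrl_hide p.2 a p'.2]
  end.

Lemma controlled_transP p b p' : controlled_trans p (Some b) p' -> A b.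
Proof. by case. Qed.

Definition controlled : LTS Act := MkLTS (init M, ctrl_init K) controlled_transP.

End Controlled.

Section ControlledCongruence.
Variables (Act : Type) (A U : set Act) (K : controller Act).
Variable f : Act * nat -> Act.
Hypothesis f_inj : injective f.

(* The letters [f (b, 0)] are moves of the controller alone, [f (a, 1)] hidden
   moves joint with the action [a] of the controlled system, and [f (b, 2)]
   visible moves [b] joint with any action of [U]. *)
Definition driver_trans (S : set Act) (q : ctrl K) (l : option Act) (q' : ctrl K) :
    Prop :=
  if l is Some x then
    [\/ exists2 b, x = f (b, 0) & A b /\ ctrl_step q (Some b) q',
        exists2 a, x = f (a, 1) & S a /\ ctrl_hide q a q'
      | exists2 b, x = f (b, 2) & [/\ A b, (U `&` S) !=set0 & ctrl_joint q b q']]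
  else ctrl_step q None q'.

(** The conditions on [S] ensure that the letters tagged 1 and 2 also belong to the alphabet of the
    renamed system. Otherwise they would not synchronise, and the driver could perform them
    alone. *)
Definition driver_alphabet (S : set Act) : set Act :=
  [set x | [\/ exists2 b, x = f (b, 0) & A b, exists2 a, x = f (a, 1) & S a
    | exists2 b, x = f (b, 2) & A b /\ (U `&` S) !=set0]].

Lemma driver_transP S q x q' : driver_trans S q (Some x) q' -> driver_alphabet S x.
Proof.
case=> [[b -> [Ab _]]|[a -> [Sa _]]|[b -> [Ab US _]]].
- by apply: Or31; exists b.
- by apply: Or32; exists a.
- by apply: Or33; exists b.
Qed.

Definition driver S : LTS Act := MkLTS (ctrl_init K) (@driver_transP S).

Definition driven_letters : set (Act * Act) :=
  [set p | p.2 = f (p.1, 1) \/ U p.1 /\ exists2 b, A b & p.2 = f (b, 2)].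

Definition restored_letters : set (Act * Act) :=
  [set p | p.1 = f (p.2, 0) \/ p.1 = f (p.2, 2)].

Definition hidden_letters : set Act := range (fun a => f (a, 1)).

Lemma driven_lettersP a x : renames driven_letters a x <->
  x = f (a, 1) \/ U a /\ exists2 b, A b & x = f (b, 2).
Proof.
split; first by case=> // -[_ []]; exists (f (a, 1)); left.
by left.
Qed.

(** Renaming offers each action [a] of [M] as [f (a, 1)] and, for [a] in [U], as every [f (b, 2)],
    so the driver decides whether it is hidden or shown, and as what. Both sides have states
    [state M * ctrl K], so this is an equality of systems and needs no semantic argument. *)
Lemma controlledE M :
  renaming (hiding (par (renaming M driven_letters) (driver (alphabet M)))
    hidden_letters) restored_letters = controlled A U K M.
Proof.
have fE b n c m : f (b, n) = f (c, m) -> b = c /\ n = m by move=> /f_inj[].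
have res0 b n : n = 0 \/ n = 2 -> renames restored_letters (f (b, n)) b.
  by move=> h; left; case: h => ->; [left|right].
have res b n c : n = 0 \/ n = 2 -> renames restored_letters (f (b, n)) c -> c = b.
  move=> h; case=> [[] /= /fE[]//|[_ []]]; exists b.
  by case: h => ->; [left|right].
have nh b n : n = 0 \/ n = 2 -> ~ hidden_letters (f (b, n)).
  by move=> h [a _ /fE[_ e]]; move: h; rewrite -e; case.
apply: LTS_ext => /=.
  apply/seteqP; split=> [c [x /= [[+ nhx] xc]]|c Ac].
    case=> [[a [Ma /driven_lettersP[xa|[_ [b Ab xb]]]]]|[[b xb Ab]|[a xa _]|[b xb [Ab _]]]].
    - by case: nhx; exists a.
    - by move: xc; rewrite xb => /res->//; right.
    - by move: xc; rewrite xb => /res->//; left.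
    - by case: nhx; exists a.
    - by move: xc; rewrite xb => /res->//; right.
  exists (f (c, 0)); split; last by apply: res0; left.
  by split; [right; apply: Or31; exists c|apply: nh; left].
have sync2 (a b : Act) : alphabet M a -> U a -> A b ->
    synchronised (renaming M driven_letters) (driver (alphabet M)) (Some (f (b, 2))).
  move=> Ma Ua Ab; split; first by exists a; split=> //; apply/driven_lettersP; right; split=> //; exists b.
  by apply: Or33; exists b => //; split=> //; exists a.
have sync1 a : alphabet M a ->
    synchronised (renaming M driven_letters) (driver (alphabet M)) (Some (f (a, 1))).
  move=> Ma; split; first by exists a; split=> //; apply/driven_lettersP; left.
  by apply: Or32; exists a.
have nsync0 b : ~ synchronised (renaming M driven_letters) (driver (alphabet M)) (Some (f (b, 0))).
  by case=> -[a [_ /driven_lettersP[/fE[]|[_ [? _ /fE[]]]]]].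
move=> [m q] [b|] [m' q'] /=.
  split.
    case=> x [[+ nhx] xb] => -[[/= sx [a [ma ax]] qx]|[/= nsx [a [ma ax]] _]|[/= nsx em qx]].
    - move/driven_lettersP: ax => [xa|[Ua [c Ac xc]]]; first by case: nhx; exists a.
      subst x; case: qx => [[d /fE[]//]|[d /fE[]//]|[d /fE[<- _] [_ _ qx]]].
      have ? := res _ _ _ (or_intror erefl) xb; subst b.
      by split=> //; right; exists a.
    - move/driven_lettersP: ax => [xa|[Ua [c Ac xc]]]; first by case: nhx; exists a.
      by subst x; case: nsx; apply: (sync2 a) => //; apply: transP ma.
    - case: qx => [[d xd [Ad qx]]|[d xd _]|[d xd [Ad [a [Ua Ma]] _]]].
      + by subst x; have ? := res _ _ _ (or_introl erefl) xb; subst b; split=> //; left.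
      + by case: nhx; exists d.
      + by subst x; case: nsx; apply: (sync2 a).
  case=> Ab [[/= <- qb]|[a [Ua ma qb]]].
    exists (f (b, 0)); split; last by apply: res0; left.
    split; last by apply: nh; left.
    by apply: Or33; split=> //=; [exact: nsync0|apply: Or31; exists b].
  have Ma := transP ma.
  exists (f (b, 2)); split; last by apply: res0; right.
  split; last by apply: nh; right.
  apply: Or31; split; first exact: sync2 Ma Ua Ab.
    by exists a; split=> //; apply/driven_lettersP; right; split=> //; exists b.
  by apply: Or33; exists b => //; split=> //; exists a.
split.
  case.
    case=> [[]//|/= [_ mm <-]|/= [_ <- qq]]; first by apply: Or31.
    by apply: Or32.
  case=> x [d _ <-] [[/= sx [a [ma /driven_lettersP ax]] qx]|[/= nsx [a [ma /driven_lettersP ax]] _]|[/= nsx em qx]].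
  - case: ax => [/fE[? _]|[_ [? _ /fE[]//]]]; subst d.
    case: qx => [[d /fE[]//]|[d /fE[<- _] [_ qx]]|[d /fE[]//]].
    by apply: Or33; exists a.
  - case: ax => [/fE[? _]|[_ [? _ /fE[]//]]]; subst d.
    by case: nsx; apply: sync1; apply: transP ma.
  - case: qx => [[? /fE[]//]|[? /fE[<- _] [Md _]]|[? /fE[]//]].
    by case: nsx; apply: sync1.
case=> [[mm <-]|[<- qq]|[a ma qa]].
- by left; apply: Or32; split.
- by left; apply: Or33; split.
right; exists (f (a, 1)); first by exists a.
have Ma := transP ma.
apply: Or31; split; first exact: sync1.
  by exists a; split=> //; apply/driven_lettersP; left.
by apply: Or32; exists a.
Qed.

End ControlledCongruence.

(** The driver depends on the alphabet of the system; equal alphabets put both systems into the same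
    context. *)
Lemma controlled_congr Act (R : LTS Act -> LTS Act -> Prop) A U K M1 M2 :
  infinite_set [set: Act] -> congruence R -> alphabet M1 = alphabet M2 ->
  R M1 M2 -> R (controlled A U K M1) (controlled A U K M2).
Proof.
move=> /infinite_absorbs_nat[f f_inj] cR e12 R12.
rewrite -!(controlledE _ _ _ f_inj) -e12.
apply: congr_renaming => //; apply: congr_hiding => //; apply: congr_parl => //.
exact: congr_renaming.
Qed.

(** * Consequences of preserving snF *)

Section ControlledPaths.
Variables (Act : Type) (A U : set Act) (K : controller Act) (M : LTS Act).
Local Notation N := (controlled A U K M).
Implicit Types (m : state M) (q : ctrl K) (w r : seq Act) (xi : nat -> Act).

(** [J q w r] relates the controller state, the word [w] shown and the word [r] performed by the
    system. These drift apart: hidden moves extend only [r], moves of the controller alone only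
    [w]. *)
Lemma controlled_invariant (J : ctrl K -> seq Act -> seq Act -> Prop) :
  (forall q w r l q', ctrl_step q l q' -> J q w r -> J q' (w ++ label_word l) r) ->
  (forall q w r a q', ctrl_hide q a q' -> J q w r -> J q' w (rcons r a)) ->
  (forall q w r a b q', ctrl_joint q b q' -> U a -> J q w r ->
     J q' (rcons w b) (rcons r a)) ->
  forall (p p' : state N) w w', weak_path p w' p' ->
    (exists2 r, weak_path (init M) r p.1 & J p.2 w r) ->
    exists2 r, weak_path (init M) r p'.1 & J p'.2 (w ++ w') r.
Proof.
move=> Jstep Jhide Jjoint p p' w w' pp'; elim: pp' w => {p p' w'}.
- by move=> p w; rewrite cats0.
- move=> p t u w' pt _ IH w [r pr Jr]; apply: IH.
  case: pt => [[pt1 <-]|[<- pt2]|[a pt1 pt2]].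
  + by exists r => //; rewrite -[r]cats0; apply: (weak_rcons pr pt1).
  + by exists r => //; rewrite -[w]cats0; apply: (Jstep _ _ _ None _ pt2).
  + exists (rcons r a); last exact: Jhide pt2 Jr.
    by rewrite -cats1; apply: (weak_rcons pr pt1).
move=> p t u b w' pt _ IH w [r pr Jr]; rewrite -cat_rcons; apply: IH.
case: pt => _ [[<- pt2]|[a [Ua pt1 pt2]]].
  by exists r => //; rewrite -cats1; apply: (Jstep _ _ _ (Some b) _ pt2).
exists (rcons r a); last exact: Jjoint pt2 Ua Jr.
by rewrite -cats1; apply: (weak_rcons pr pt1).
Qed.

Lemma controlled_tau m m' q :
  weak_path m [::] m' -> weak_path ((m, q) : state N) [::] (m', q).
Proof.
move E : [::] => w mm'; elim: mm' E => {m m' w} [m _|m t u w mt _ IH /IH tu|//].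
  exact: weak_nil.
by apply: weak_tau tu; apply: Or31.
Qed.

Lemma controlled_hide m a m' q q' :
  weak_path m [:: a] m' -> ctrl_hide q a q' ->
  weak_path ((m, q) : state N) [::] (m', q').
Proof.
move E : [:: a] => w mm'; elim: mm' E => {m m' w} [//|m t u w mt _ IH|m t u b w mt tu _].
  by move=> /IH{}IH /IH; apply: weak_tau; apply: Or31.
move=> [eb ew] qq'; apply: (@weak_tau _ N _ (t, q')).
  by apply: Or33; exists a; [rewrite eb|].
by apply: controlled_tau; rewrite ew.
Qed.

Lemma controlled_run (g : nat -> ctrl K) xi i n m m' :
  (forall j, i <= j < i + n -> ctrl_hide (g j) (xi j) (g j.+1)) ->
  weak_path m [seq xi j | j <- iota i n] m' ->
  weak_path ((m, g i) : state N) [::] (m', g (i + n)).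
Proof.
elim: n i m => [|n IH] i m gP.
  by rewrite addn0; apply: controlled_tau.
rewrite /= -cat1s => /weak_split[t mt tm'].
apply: (@weak_cat _ N _ (t, g i.+1) _ [::] [::]).
  by apply: controlled_hide mt _; apply: gP; rewrite leqnn addnS ltnS leq_addr.
rewrite addnS -addSn; apply: IH tm' => j /andP[ij jn].
by apply: gP; rewrite ltnW //= addnS -addSn.
Qed.

Lemma controlled_diverges m q : diverges ((m, q) : state N) ->
  diverges m \/ exists m1 m2 q',
    [/\ weak_path m [::] m1,
        m1 = m2 /\ ctrl_step q None q' \/
          (exists2 a, trans m1 (Some a) m2 & ctrl_hide q a q')
      & diverges ((m2, q') : state N)].
Proof.
move=> div; have [|H] := pselect (exists m1 m2 q',
    [/\ weak_path m [::] m1,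
        m1 = m2 /\ ctrl_step q None q' \/
          (exists2 a, trans m1 (Some a) m2 & ctrl_hide q a q')
      & diverges ((m2, q') : state N)]); first by right.
left; apply: (@diverges_coind _ _
  (fun t => weak_path m [::] t /\ diverges ((t, q) : state N))).
  by split=> //; apply: weak_nil.
move=> t [mt /diverges_step[[t' q'] /= tt' div']].
case: tt' => /= [[tt' qq']|[tt' qq']|[a tt' qq']].
- by subst q'; exists t' => //; split=> //; apply: (weak_rcons (l := None) mt).
- by subst t'; case: H; exists t, t, q'; split=> //; left.
- by case: H; exists t, t', q'; split=> //; right; exists a.
Qed.

End ControlledPaths.

(** * Semantics of the action prefix *)

Section Prefix.
Variables (Act : Type) (c : Act) (L : LTS Act).
Implicit Types (s t : state L) (w : seq Act) (xi : nat -> Act).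
Local Notation PL := (pref c L).

Lemma pref_weak_path s w (p : state PL) :
  weak_path (Some s : state PL) w p <-> exists2 t, p = Some t & weak_path s w t.
Proof.
split.
  move E : (Some s : state PL) => p0 p0p; elim: p0p s E => {p0 p w}.
  - by move=> _ s <-; exists s => //; apply: weak_nil.
  - move=> p0 [u|] p w + _ IH s E; last by rewrite -E.
    by rewrite -E /= => su; have [t -> ut] := IH u erefl; exists t => //; apply: weak_tau su ut.
  - move=> p0 [u|] p a w + _ IH s E; last by rewrite -E.
    by rewrite -E /= => su; have [t -> ut] := IH u erefl; exists t => //; apply: weak_vis su ut.
case=> t -> st; elim: st => {s t w} [s|s t u w st _ IH|s t u a w st _ IH].
- exact: weak_nil.
- by apply: weak_tau IH.
- by apply: weak_vis IH.
Qed.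

Lemma pref_weak_path_init w (p : state PL) :
  weak_path (init PL) w p <-> w = [::] /\ p = init PL \/
  exists sigma t, [/\ w = c :: sigma, p = Some t & weak_path (init L) sigma t].
Proof.
split.
  move E : (init PL) => p0 p0p; case: p0p E => {p0 p w}.
  - by move=> p _; left.
  - by move=> p0 [u|] p w + _ E; rewrite -E //= => -[].
  - move=> p0 [u|] p a w + up E; rewrite -E //= => -[[->] uL]; right.
    by move/pref_weak_path: up => [t -> ut]; exists w, t; rewrite -uL.
case=> [[-> ->]|[w' [t [-> -> Lt]]]]; first exact: weak_nil.
by apply: (@weak_vis _ PL _ (Some (init L))) => //; apply/pref_weak_path; exists t.
Qed.

Lemma pref_diverges s : diverges (Some s : state PL) <-> diverges s.
Proof.
split=> div.
  apply: (@diverges_coind _ _ (fun t => diverges (Some t : state PL)) _ div).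
  by move=> t /diverges_step[[u|//] tu divu]; exists u.
apply: (@diverges_coind _ PL (fun p => exists2 t, p = Some t & diverges t)).
  by exists s.
move=> _ [t -> /diverges_step[u tu divu]]; exists (Some u) => //.
by exists u.
Qed.

Lemma pref_init_stable (p : state PL) : ~ trans (init PL) None p.
Proof. by case: p => [p|] //= []. Qed.

Lemma pref_Div_nil : ~ Div PL [::].
Proof.
case=> p [/pref_weak_path_init[[_ ->]|[? [? []//]]] /diverges_step[u]].
by move/pref_init_stable.
Qed.

Lemma pref_Div_cons w : Div PL (c :: w) <-> Div L w.
Proof.
split.
  case=> p [/pref_weak_path_init[[]//|[w' [t [[->] -> Lt]]]] /pref_diverges div].
  by exists t.
case=> t [Lt div]; exists (Some t); split; last exact/pref_diverges.
by apply/pref_weak_path_init; right; exists w, t.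
Qed.

Lemma pref_Inf xi : Inf PL (fun i => if i is j.+1 then xi j else c) <-> Inf L xi.
Proof.
split.
  move=> /weak_inf_path_steps[q q0 qP].
  apply: (weak_inf_path_coind (P := fun u i =>
    exists2 t, q i.+1 = Some t & weak_path u [::] t)).
    have := qP 0; rewrite q0 => /pref_weak_path_init[[]//|[w [t [[<-] -> Lt]]]].
    by exists t.
  move=> u i [t qt ut]; have := qP i.+1; rewrite qt => /pref_weak_path[t' -> tt'].
  exists t'; first exact: (weak_cat ut tt').
  by exists t' => //; apply: weak_nil.
move=> /weak_inf_path_steps[q q0 qP].
apply: (weak_inf_path_steps_rev (L := PL)
  (q := fun i => if i is j.+1 then Some (q j) else None)) => -[|i].
  apply/pref_weak_path_init; right; exists [::], (q 0); split=> //.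
  by rewrite q0; apply: weak_nil.
by apply/pref_weak_path; exists (q i.+1).
Qed.

End Prefix.

(** * Preservation of the alphabet, of divergences and of eventually nondivergent infinite traces *)

Section Preservation.
Variables (Act : Type) (R : LTS Act -> LTS Act -> Prop).
Hypothesis (Act_infinite : infinite_set [set: Act]) (R_congruence : congruence R).
Hypothesis R_snF : preserves R (@snF Act).

Lemma stop_transP (A : set Act) (s : unit) a (s' : unit) : False -> A a.
Proof. by []. Qed.

Definition stop (A : set Act) : LTS Act :=
  @MkLTS Act unit A (fun _ _ _ => False) tt (@stop_transP A).

(** As [b] differs from [a], the prefixed system can initially do neither tau nor [a]. The empty
    trace therefore refuses [[set a]] as soon as [a] is in the alphabet, and [snF] reveals this
    membership. *)
Lemma snF_preserves_alphabet L L' : R L L' -> alphabet L = alphabet L'.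
Proof.
suff H M M' : R M M' -> alphabet M `<=` alphabet M'.
  by move=> LL'; apply/seteqP; split; apply: H => //; apply: congr_sym.
move=> MM' a Ma.
have [b ba] : exists b, b <> a.
  apply: contrapT => nb; apply: Act_infinite; apply: (sub_finite_set (B := [set a])).
    by move=> b _; apply: contrapT => ba; apply: nb; exists b.
  exact: finite_set1.
have /R_snF snFE : R (par (pref b M) (stop (~` [set a]))) (par (pref b M') (stop (~` [set a]))).
  by apply: congr_parl => //; apply: congr_pref.
pose ctx X := par (pref b X) (stop (~` [set a])).
have quiet X l p : trans (init (ctx X)) l p -> l <> None /\ l <> Some a.
  case: p => p [] [[sy _ []]|[ns tp _]|[_ _ []]].
  split; first by move=> l0; move: tp; rewrite l0; apply: pref_init_stable.
  by move=> la; move: tp; rewrite la; case: p => [x|] //= [[ab] _]; apply: ba.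
have quiet_path X w p : weak_path (init (ctx X)) w p -> p <> init (ctx X) -> head b w <> a /\ w <> [::].
  move E : (init (ctx X)) => p0 p0p; case: p0p E => {p0 w p}.
  - by move=> p _ [].
  - by move=> p0 u p w + _ E; rewrite -E => /quiet[].
  by move=> p0 u p d w + _ E; rewrite -E => /quiet[_ da] _; split=> // da'; apply: da; rewrite -da'.
have quiet_Div X w : Div (ctx X) w -> head b w <> a /\ w <> [::].
  case=> p [wp div]; apply: quiet_path wp _ => pE.
  by move: div; rewrite pE => /diverges_step[u /quiet[]].
have : snF (ctx M) ([::], [set a]).
  split; last by move=> x -> /quiet_Div[].
  split; last by move=> /quiet_Div[].
  split=> [x -> /=|]; first by left; left.
  exists (init (ctx M)); split; first exact: weak_nil.
    by move=> x -> p /quiet[].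
  by move=> p /quiet[].
rewrite snFE => -[[[sub _] _] _].
by case: (sub a erefl) => [[|/esym/ba]|/(_ erefl)].
Qed.

Lemma inhabited_act : exists c : Act, True.
Proof. by have [c _] := infinite_setN0 Act_infinite; exists c. Qed.

(* Before [c] the controlled system is stable, so the trace [v] always carries a
   stable failure; the controlled system can diverge after [v] only if it has
   performed all of [rho]. *)
Definition divergence_tester (v : Act) (rho : seq Act) : controller Act :=
  @Controller Act (option nat) (Some 0)
    (fun q l q' => [/\ l = Some v, q' = None & q = Some 0 \/ q = Some (size rho)])
    (fun q a q' => exists j,
       [/\ j < size rho, q = Some j, a = nth v rho j & q' = Some j.+1])
    (fun _ _ _ => False).

Lemma snF_preserves_Div_sub L L' : R L L' -> Div L `<=` Div L'.
Proof.
move=> LL' sigma LD; apply: contrapT => nL'D.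
have [c _] := inhabited_act.
(* The system is prefixed with [c] to be stable initially, so the word it has to perform is
   [c :: sigma]. *)
pose K := divergence_tester c (c :: sigma).
have eL : alphabet (pref c L) = alphabet (pref c L').
  by rewrite /= (snF_preserves_alphabet LL').
pose N X := controlled setT set0 K (pref c X).
have /R_snF snFE : R (N L) (N L').
  by apply: controlled_congr => //; apply: congr_pref.
have : snF (N L') ([:: c], set0).
  split=> //; split.
    split=> //; exists ((None, None) : state (N L')); split=> //.
      apply: (@weak_vis _ (N L') _ (None, None)); last exact: weak_nil.
      by split=> //; left; split=> //; split=> //; left.
    by move=> [p q] [[tp _]|[_ []//]|[a _ [j []]]//]; exact: pref_init_stable tp.
  case=> -[p q] [wp /controlled_diverges div].
  (* Once the tester has shown its letter, the system has performed nothing or all of [c :: sigma],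
     and neither is a divergence of [pref c L']. *)
  pose J (q : option nat) (w r : seq Act) := match q with
      | Some j => w = [::] /\ r = take j (c :: sigma)
      | None => w = [:: c] /\ (r = [::] \/ r = c :: sigma)
      end.
  have [] := controlled_invariant (K := K) (J := J) _ _ _ wp (w := [::]).
  - move=> q0 w r l q' [-> -> []] ->; first by move=> [-> ->]; split; [|left].
    by move=> [-> ->]; split=> //; right; rewrite take_size.
  - move=> q0 w r a q' [j [jn -> -> ->]] [-> ->]; split=> //.
    by rewrite (take_nth c).
  - by [].
  - by exists [::]; [apply: weak_nil|].
  move=> r /= rp; case: q {wp} div => [j _ []//|div [_ h]].
  have {div} div : diverges p.
    by case: div => // -[? [? [? [_ [[_ []//]|[? _ [? []//]]] _]]]].
  case: h => h; subst r; first by apply: (@pref_Div_nil _ c L'); exists p.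
  by apply: nL'D; apply/(pref_Div_cons c); exists p.
rewrite -snFE => -[[_ nD] _]; apply: nD.
have [s [Ls div]] := LD.
exists ((Some s, None) : state (N L)); split.
  apply: (@weak_cat _ (N L) _ (Some s, Some (size (c :: sigma))) _ [::]).
    apply: (controlled_run _ _ (K := K) (M := pref c L) (g := fun j => Some j)
      (xi := nth c (c :: sigma)) (i := 0) (n := size (c :: sigma))).
      by move=> j /andP[_ jn]; exists j.
    rewrite -/(mkseq _ _) mkseq_nth; apply/pref_weak_path_init; right.
    by exists sigma, s.
  apply: (@weak_vis _ (N L) _ (Some s, None)); last exact: weak_nil.
  by split=> //; left; split=> //; split=> //; right.
apply: (@diverges_coind _ (N L) (fun p => exists2 t, p = (Some t, None) & diverges t)).
  by exists s.
move=> _ [t -> /diverges_step[u tu divu]]; exists (Some u, None); last by exists u.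
exact: Or31.
Qed.

Lemma snF_preserves_Div L L' : R L L' -> Div L = Div L'.
Proof.
move=> LL'; apply/seteqP; split; apply: snF_preserves_Div_sub => //.
exact: congr_sym.
Qed.

(** The letter [v] marks that [n] letters of [xi] have been performed. Divergences of the system at
    shorter prefixes thus do not affect the trace [[:: v]]: if the prefixes from length [n] on are
    nondivergent, a divergence after [v] must follow [xi] forever. *)
Definition infinite_trace_tester (v : Act) (xi : nat -> Act) (n : nat) :
    controller Act :=
  @Controller Act (bool * nat) (false, 0)
    (fun q l q' => [/\ q = (false, n), l = Some v & q' = (true, n)])
    (fun q a q' => [/\ a = xi q.2, q'.1 = q.1 & q'.2 = q.2.+1])
    (fun _ _ _ => False).

Lemma snF_preserves_eanI_sub L L' : R L L' -> eanI L `<=` eanI L'.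
Proof.
move=> LL' xi [Lxi [n nD]]; move: (nD); rewrite (snF_preserves_Div LL') => nD'.
split; last by exists n.
have [c _] := inhabited_act.
pose N X := controlled setT set0 (infinite_trace_tester c xi n) X.
have /snF_preserves_Div DivE : R (N L) (N L').
  by apply: controlled_congr => //; apply: snF_preserves_alphabet.
have : Div (N L) [:: c].
  have [q q0 qP] := weak_inf_path_steps Lxi.
  have pre m : weak_path (init L) (mkseq xi m) (q m).
    elim: m => [|m IH]; first by rewrite q0; apply: weak_nil.
    by rewrite mkseqS -cats1; apply: weak_cat IH (qP m).
  exists ((q n, (true, n)) : state (N L)); split.
    apply: (@weak_cat _ (N L) _ (q n, (false, n)) _ [::]).
      apply: (controlled_run _ _ (K := infinite_trace_tester c xi n) (M := L)
        (g := fun j => (false, j)) (xi := xi) (i := 0) (n := n)) => //.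
      exact: pre.
    apply: (@weak_vis _ (N L) _ (q n, (true, n))); last exact: weak_nil.
    by split=> //; left.
  (* Invariant: the weak step towards [q i.+1] is under way. Its visible transition becomes a hidden
     move of the tester. *)
  apply: (@diverges_coind _ (N L) (fun p => exists i,
    p.2 = (true, i) /\ weak_path p.1 [:: xi i] (q i.+1))); first by exists n; split; [|exact: qP].
  move=> [p _] [i [/= -> pq]].
  move E : [:: xi i] pq (qP i.+1) => w; move E' : (q i.+1) => q' pq.
  case: pq E E' => [//|p0 t u w' pt tu E E' _|p0 t u a w' pt tu [ea ew] E' q'q].
    by exists (t, (true, i)); [apply: Or31|exists i; rewrite /= E E'].
  exists (t, (true, i.+1)); first by apply: Or33; exists a => //; split.
  exists i.+1; split=> //=; apply: (weak_cat (sigma := [::]) (t := u)); first by rewrite ew.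
  exact: q'q.
rewrite DivE => -[[p [b j]] [wp div]].
pose J (q : bool * nat) (w r : seq Act) :=
   [/\ r = mkseq xi q.2, w = (if q.1 then [:: c] else [::]) & q.1 -> n <= q.2].
have [] := controlled_invariant (K := infinite_trace_tester c xi n) (J := J)
  _ _ _ wp (w := [::]).
- by move=> q w r l q' [-> -> ->] [-> -> _]; split.
- move=> [b0 j0] w r a [b1 j1] /= [-> -> ->] [-> -> h]; split=> //.
    by rewrite mkseqS.
  by move=> /h /leqW.
- by [].
- by exists [::]; [apply: weak_nil|].
move=> r /= rp [/= er]; case: b wp div => // wp div _ /(_ erefl) nj; subst r.
apply: (weak_inf_path_prefix rp).
apply: (weak_inf_path_coind (P := fun m i =>
  weak_path (init L') (mkseq xi (j + i)) m /\
  diverges ((m, (true, j + i)) : state (N L')))).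
  by rewrite addn0.
move=> t i [Lt /controlled_diverges[divt|]].
  by case: (nD' (j + i)); [apply: leq_trans nj (leq_addr _ _)|exists t].
move=> [m1 [m2 [[b1 j1] [tm1 [[_ [//]]|[a m12 /= [ea -> ->]]] div2]]]].
exists m2; first by rewrite -ea; apply: (weak_rcons (l := Some a) tm1).
rewrite addnS; split=> //.
rewrite mkseqS -cats1; apply: weak_cat Lt _.
by rewrite /= -ea; apply: (weak_rcons (l := Some a) tm1).
Qed.

Lemma snF_preserves_eanI L L' : R L L' -> eanI L = eanI L'.
Proof.
move=> LL'; apply/seteqP; split; apply: snF_preserves_eanI_sub => //.
exact: congr_sym.
Qed.

End Preservation.

(** * Extensions of a transition system by a controller *)

Definition traces (Act : Type) (L : LTS Act) : set (seq Act) :=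
  [set w | exists s, weak_path (init L) w s].

Lemma traces_prefix Act (L : LTS Act) u w : traces L (u ++ w) -> traces L u.
Proof. by case=> s /weak_split[t ut _]; exists t. Qed.

Lemma Div_traces Act (L : LTS Act) w : Div L w -> traces L w.
Proof. by case=> s [ws _]; exists s. Qed.

Lemma weak_path_alphabet Act (L : LTS Act) (s t : state L) a w :
  weak_path s (a :: w) t -> alphabet L a.
Proof.
move E : (a :: w) => w' st; elim: st E => // {t w'} s0 t u b w' st _ _ [-> _].
exact: transP st.
Qed.

(** [ext_word x] is the word shown when [x] is reached. [ext_rank] has to decrease along [ext_hide],
    which excludes endless hidden moves. [ext_leave x l s] hands control to the state [s] of [L]. *)
Record extension (Act : Type) (L : LTS Act) := Extension {
  ext : Type;
  ext_word : ext -> seq Act;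
  ext_rank : ext -> nat;
  ext_entry : ext -> Prop;
  ext_step : ext -> Act -> ext -> Prop;
  ext_hide : ext -> Act -> ext -> Prop;
  ext_joint : ext -> Act -> ext -> Prop;
  ext_leave : ext -> option Act -> state L -> Prop }.

(** [Walk pre post] has shown [pre] and may still show [post]. In [Plain s] the controller runs [L],
    and the system is left with its own tau-moves. *)
Inductive ext_state (Act : Type) (L : LTS Act) (E : extension L) : Type :=
  | Start
  | Walk of seq Act & seq Act
  | Plain of state L
  | Extra of ext E.

Arguments Start {Act L E}.
Arguments Walk {Act L E}.
Arguments Plain {Act L E}.
Arguments Extra {Act L E}.

Section ExtensionController.
Variables (Act : Type) (L : LTS Act) (E : extension L).
Implicit Types (q : ext_state E) (l : option Act).

(* From [Start] the controller either becomes [L] or commits to a trace [post] of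
   [L], which bounds the walk, so that walking adds no infinite trace. *)
Definition extension_step q l q' : Prop :=
  match q, q' with
  | Start, Walk pre post => [/\ l = None, pre = [::] & traces L post]
  | Walk pre post, Walk pre' post' =>
      exists a, [/\ l = Some a, post = a :: post' & pre' = rcons pre a]
  | Walk pre post, Plain s => l = None /\ weak_path (init L) pre s
  | Walk pre post, Extra x =>
      [/\ l = None, post = [::], ext_word x = pre & ext_entry x]
  | Plain s, Plain s' => trans s l s'
  | Extra x, Plain s => ext_leave x l s
  | Extra x, Extra x' => exists2 a, l = Some a & ext_step x a x'
  | _, _ => False
  end.

Definition on_extra (r : ext E -> Act -> ext E -> Prop) q (a : Act) q' : Prop :=
  match q, q' with Extra x, Extra x' => r x a x' | _, _ => False end.

Definition extension_controller : controller Act :=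
  Controller Start extension_step (on_extra (@ext_hide _ _ E))
    (on_extra (@ext_joint _ _ E)).

(* [used x r]: the controlled system may have performed [r] when the controller
   is in [x]; [D] is the divergence set of the controlled system. *)
Record sound (D : set (seq Act)) (U : set Act) (used : ext E -> seq Act -> Prop) :
    Prop := Sound {
  sound_nil : ~ D [::];
  sound_entry : forall x, ext_entry x -> used x [::];
  sound_step : forall x a x' r, ext_step x a x' -> used x r ->
    used x' r /\ ext_word x' = rcons (ext_word x) a;
  sound_hide : forall x a x' r, ext_hide x a x' -> used x r ->
    [/\ used x' (rcons r a), ext_word x' = ext_word x & ext_rank x' < ext_rank x];
  sound_joint : forall x a b x' r, ext_joint x b x' -> U a -> used x r ->
    used x' (rcons r a) /\ ext_word x' = rcons (ext_word x) b;
  sound_leave : forall x l s r, ext_leave x l s -> used x r ->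
    ~ D r /\ weak_path (init L) (ext_word x ++ label_word l) s;
  sound_Div : forall x r, used x r -> D r -> Div L (ext_word x) }.

End ExtensionController.

Section Extended.
Variables (Act : Type) (L : LTS Act) (E : extension L) (U : set Act) (M : LTS Act).
Variable used : ext E -> seq Act -> Prop.
Hypothesis snd : sound (Div M) U used.

Definition extended : LTS Act := controlled (alphabet L) U (extension_controller E) M.
Local Notation N := extended.

(** In [Plain s] the tau-moves of the system could still make the composite diverge where [L] does
    not. Hence its word must be nondivergent there, which is what [sound_leave] provides. *)
Definition consistent (q : ext_state E) (w r : seq Act) : Prop :=
  match q with
  | Start => w = [::] /\ r = [::]
  | Walk pre post => [/\ pre = w, r = [::] & traces L (pre ++ post)]
  | Plain s => weak_path (init L) w s /\ ~ Div M r
  | Extra x => ext_word x = w /\ used x r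
  end.

Lemma consistent_step q w r l q' :
  extension_step q l q' -> consistent q w r -> consistent q' (w ++ label_word l) r.
Proof.
case: q => [|pre post|s|x]; case: q' => [|pre' post'|s'|x'] //=.
- by move=> [-> -> Lp] [-> ->].
- by move=> [a [-> -> ->]] [-> -> Lp]; rewrite -cats1 -catA.
- by move=> [-> ps] [<- -> _]; rewrite cats0; split=> //; apply: sound_nil snd.
- by move=> [-> _ -> ex] [<- -> _]; rewrite cats0; split=> //; apply: (sound_entry snd).
- by move=> ss' [ws nD]; split=> //; apply: weak_rcons ws ss'.
- by move=> xs [<- xr]; have [] := sound_leave snd xs xr.
- by move=> [a -> xx'] [<- xr]; have [? ->] := sound_step snd xx' xr; rewrite cats1.
Qed.

Lemma consistent_hide q w r a q' :
  on_extra (@ext_hide _ _ E) q a q' -> consistent q w r -> consistent q' w (rcons r a).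
Proof.
case: q => [|pre post|s|x]; case: q' => [|pre' post'|s'|x'] //= xx' [<- xr].
by have [] := sound_hide snd xx' xr.
Qed.

Lemma consistent_joint q w r a b q' :
  on_extra (@ext_joint _ _ E) q b q' -> U a -> consistent q w r ->
  consistent q' (rcons w b) (rcons r a).
Proof.
case: q => [|pre post|s|x]; case: q' => [|pre' post'|s'|x'] //= xx' Ua [<- xr].
by have [] := sound_joint snd xx' Ua xr.
Qed.

Lemma extended_consistent w (p : state N) : weak_path (init N) w p ->
  exists2 r, weak_path (init M) r p.1 & consistent p.2 w r.
Proof.
move=> wp; have := controlled_invariant (K := extension_controller E)
  consistent_step consistent_hide consistent_joint wp (w := [::]).
by apply; exists [::]; [apply: weak_nil|].
Qed.

Lemma extended_plain (p p' : state N) s w : weak_path p w p' -> p.2 = Plain s ->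
  exists2 s', p'.2 = Plain s' & weak_path s w s'.
Proof.
move=> pp'; elim: pp' s => {p p' w} [p|p t u w pt _ IH|p t u a w pt _ IH] s ps.
- by exists s => //; apply: weak_nil.
- case: pt; rewrite ps; [by case=> _ /esym/IH| |by case].
  case=> _; case tE : (t.2) => [|pre post|s'|x] //= ss'.
  by have [s'' us' s's''] := IH _ tE; exists s'' => //; apply: weak_tau ss' s's''.
- case: pt; rewrite ps => _ []; last by case=> b [].
  case=> _; case tE : (t.2) => [|pre post|s'|x] //= ss'.
  by have [s'' us' s's''] := IH _ tE; exists s'' => //; apply: weak_vis ss' s's''.
Qed.

Lemma extended_plain_lift m s s' w : weak_path s w s' ->
  weak_path ((m, Plain s) : state N) w (m, Plain s').
Proof.
elim=> {s s' w} [s|s t u w st _|s t u a w st _]; first exact: weak_nil.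
  by apply: weak_tau; apply: Or32.
by apply: weak_vis; split; [exact: transP st|left].
Qed.

Lemma extended_plain_diverges m s : ~ diverges m ->
  diverges ((m, Plain s) : state N) <-> diverges s.
Proof.
move=> nd; split=> div.
  apply: (@diverges_coind _ _ (fun s => exists2 m, ~ diverges m &
    diverges ((m, Plain s) : state N))); first by exists m.
  move=> t {}[m' nd' /controlled_diverges[//|[m1 [m2 [q' [m'm1 + div']]]]]].
  case=> [[em tq]|[a _ //]]; case: q' tq div' => // t' tt' div'.
  by exists t' => //; exists m2 => // div2; apply: nd'; apply: weak_diverges m'm1 _; rewrite em.
apply: (@diverges_coind _ N (fun p => exists2 t, p = (m, Plain t) & diverges t)).
  by exists s.
move=> _ [t -> /diverges_step[u tu divu]]; exists (m, Plain u); last by exists u.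
exact: Or32.
Qed.

Lemma extended_start : weak_path (init N) [::] (init M, Plain (init L)).
Proof.
apply: (@weak_tau _ N _ (init M, Walk [::] [::])).
  by apply: Or32; split=> //; split=> //; exists (init L); apply: weak_nil.
apply: (@weak_tau _ N _ (init M, Plain (init L))); last exact: weak_nil.
by apply: Or32; split=> //; split=> //; apply: weak_nil.
Qed.

Lemma extended_walk pre post : traces L (pre ++ post) ->
  weak_path ((init M, Walk pre post) : state N) post (init M, Walk (pre ++ post) [::]).
Proof.
elim: post pre => [|a post IH] pre Lpp; first by rewrite cats0; apply: weak_nil.
rewrite -cat_rcons; apply: (@weak_vis _ N _ (init M, Walk (rcons pre a) post)).
  split; last by left; split=> //; exists a.
  by have [s /weak_split[t _ ts]] := Lpp; apply: weak_path_alphabet ts.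
by apply: IH; rewrite cat_rcons.
Qed.

Lemma extended_entry x : traces L (ext_word x) -> ext_entry x ->
  weak_path (init N) (ext_word x) (init M, Extra x).
Proof.
move=> Lx ex; apply: (@weak_tau _ N _ (init M, Walk [::] (ext_word x))).
  exact: Or32.
rewrite -[X in weak_path _ X _]cats0; apply: weak_cat (extended_walk (pre := [::]) Lx) _.
apply: (@weak_tau _ N _ (init M, Extra x)); last exact: weak_nil.
exact: Or32.
Qed.

(** In [Extra] the rank admits only finitely many hidden moves. After them either [M] diverges
    alone, which [sound_Div] covers, or control has passed to [L], where [M] cannot diverge. *)
Lemma extended_diverges m q w r : weak_path (init M) r m -> consistent q w r ->
  diverges ((m, q) : state N) -> Div L w.
Proof.
have plain m' s w' r' : weak_path (init M) r' m' -> consistent (Plain s) w' r' ->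
    diverges ((m', Plain s) : state N) -> Div L w'.
  move=> rm [ws nD]; rewrite extended_plain_diverges => [div|div]; first by exists s.
  by apply: nD; exists m'.
have extra n : forall m' x w' r', ext_rank x < n -> weak_path (init M) r' m' ->
    consistent (Extra x) w' r' -> diverges ((m', Extra x) : state N) -> Div L w'.
  elim: n => // n IH m' x w' r' xn rm cx /controlled_diverges[div|].
    by have [<- xr] := cx; apply: (sound_Div snd xr); exists m'.
  move=> [m1 [m2 [q' [mm1 st div]]]].
  have rm1 : weak_path (init M) r' m1 by rewrite -[r']cats0; apply: weak_cat rm mm1.
  case: st => [[em xq]|[a m12 xq]].
    have /= := consistent_step xq cx; rewrite cats0; subst m2.
    by case: q' xq div => [|//|s _ div|x' [//]] // cs; apply: (plain _ _ _ _ rm1 cs div).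
  have cq := consistent_hide xq cx.
  case: q' xq cq div => // x' xx' cq div.
  apply: (IH _ _ _ _ _ _ cq div); last by rewrite -cats1; apply: (weak_rcons (l := Some a) rm1).
  have [_ xr] := cx; have [_ _ lt] := sound_hide snd xx' xr.
  by rewrite -ltnS; apply: leq_trans lt xn.
have walk m' pre post w' r' : weak_path (init M) r' m' ->
    consistent (Walk pre post) w' r' ->
    diverges ((m', Walk pre post) : state N) -> Div L w'.
  move=> rm cx /controlled_diverges[div|].
    by have [_ r0 _] := cx; case: (sound_nil snd); exists m'; rewrite -r0.
  move=> [m1 [m2 [q' [mm1 [[em xq]|[a _ //]] div]]]].
  have rm1 : weak_path (init M) r' m1 by rewrite -[r']cats0; apply: weak_cat rm mm1.
  have /= := consistent_step xq cx; rewrite cats0; subst m2.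
  case: q' xq div => [//|? ? [? [//]]|s _ div|x _ div].
    by move=> cs; apply: (plain _ _ _ _ rm1 cs div).
  by move=> cx'; apply: (extra _ _ _ _ _ (ltnSn _) rm1 cx' div).
case: q => [|pre post|s|x].
- move=> rm cx /controlled_diverges[div|].
    by have [_ r0] := cx; case: (sound_nil snd); exists m; rewrite -r0.
  move=> [m1 [m2 [q' [mm1 [[em xq]|[a _ //]] div]]]].
  have rm1 : weak_path (init M) r m1 by rewrite -[r]cats0; apply: weak_cat rm mm1.
  have /= := consistent_step xq cx; rewrite cats0; subst m2.
  by case: q' xq div => // pre post _ div cw; apply: (walk _ _ _ _ _ rm1 cw div).
- exact: walk.
- exact: plain.
- exact: extra (ltnSn _).
Qed.

Lemma init_nondiverges : ~ diverges (init M).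
Proof. by move=> div; apply: (sound_nil snd); exists (init M); split=> //; apply: weak_nil. Qed.

Lemma extended_Div : Div N = Div L.
Proof.
apply/seteqP; split=> w.
  move=> [[m q] [wp div]]; have [r rm cq] := extended_consistent wp.
  exact: extended_diverges rm cq div.
move=> [s [ws div]]; exists (init M, Plain s); split.
  exact: (weak_cat extended_start (extended_plain_lift (init M) ws)).
by apply/extended_plain_diverges; first exact: init_nondiverges.
Qed.

Definition extra_failure (f : seq Act * set Act) : Prop :=
  f.2 `<=` alphabet L /\ exists m x,
    [/\ weak_path (init N) f.1 (m, Extra x),
        forall a, f.2 a -> forall p', ~ trans ((m, Extra x) : state N) (Some a) p'
      & forall p', ~ trans ((m, Extra x) : state N) None p'].

(** [Start] and [Walk] always have a silent exit, so new failures come from [Extra] alone. To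
    realise a failure of [L], the system is brought to a stable state, since its tau-moves would
    spoil stability. *)
Lemma extended_Sf f : Sf N f <-> Sf L f \/ extra_failure f.
Proof.
split.
  move=> [fA [[m q] [wp ref stab]]]; have [r /= rm cq] := extended_consistent wp.
  case: q cq wp ref stab => [|pre post|s|x] cq wp ref stab.
  - case: (stab (m, Walk [::] [::])); apply: Or32; split=> //; split=> //.
    by exists (init L); apply: weak_nil.
  - have [_ _ /traces_prefix[s ps]] := cq.
    by case: (stab (m, Plain s)); apply: Or32.
  - left; split=> //; exists s; split; first by have [] := cq.
      move=> a fa s' ss'; apply: (ref a fa (m, Plain s')); split; last by left.
      exact: fA.
    by move=> s' ss'; apply: (stab (m, Plain s')); apply: Or32.
  - by right; split=> //; exists m, x.
case=> [[fA [s [ws ref stab]]]|[fA [m [x [wp ref stab]]]]]; last first.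
  by split=> //; exists (m, Extra x).
have [m Mm mstab] := nondiverges_stable init_nondiverges.
split=> //; exists (m, Plain s); split.
- rewrite -[f.1]cats0; apply: weak_cat (controlled_tau _ _ _ Mm).
  exact: (weak_cat extended_start (extended_plain_lift (init M) ws)).
- move=> a fa [m' q'] [_ [[_]|[b [_ _]]]]; case: q' => //= s'.
  exact: ref.
- by move=> [m' q'] [[/mstab]|[_]|[a _]] //; case: q' => // s'; apply: stab.
Qed.

Lemma extended_extra w m x : weak_path (init N) w (m, Extra x) ->
  ext_word x = w /\ exists2 r, weak_path (init M) r m & used x r.
Proof. by move=> /extended_consistent[r rm [xw xr]]; split=> //; exists r. Qed.

Lemma extended_extra_trans (p t : state N) l x : trans p l t -> p.2 = Extra x ->
  (exists s, t.2 = Plain s) \/ exists x', t.2 = Extra x'.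
Proof.
move=> pt px; move: pt; case: l => [a|] /=; rewrite /controlled_trans px /=.
  by case=> _ [[_]|[b [_ _]]]; case: (t.2) => // y _;
    first [by left; exists y|by right; exists y].
case=> [[_ <-]|[_]|[b _]]; first (by right; exists x); case: (t.2) => // y _;
  first [by left; exists y|by right; exists y].
Qed.

Lemma extended_extra_step (p p' : state N) w x : weak_path p w p' -> p.2 = Extra x ->
  (exists s, p'.2 = Plain s) \/ exists x', p'.2 = Extra x'.
Proof.
move=> pp'; elim: pp' x => {p p' w} [p|p t u w pt tu IH|p t u a w pt tu IH] x px.
  by right; exists x.
all: case: (extended_extra_trans pt px) => [[s]|[y /IH]//].
all: by move=> /(extended_plain tu)[s' -> _]; left; exists s'.
Qed.

Lemma extended_walk_trans (p t : state N) l :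
  trans p l t ->
  (t.2 = Start -> p.2 = Start) /\
  forall pre' post', t.2 = Walk pre' post' -> p.2 = Start \/
    exists pre post, p.2 = Walk pre post /\
      size post = size (label_word l) + size post'.
Proof.
move=> pt; have qt : p.2 = t.2 /\ l = None \/ extension_step p.2 l t.2 \/
    exists r a, on_extra r p.2 a t.2.
  case: l pt => [a|] /=; rewrite /controlled_trans.
    by move=> [_ [[_]|[b [_ _]]]]; [right; left|right; right; exists (@ext_joint _ _ E), a].
  case=> [[_]|[_]|[b _]]; first by left.
    by right; left.
  by right; right; exists (@ext_hide _ _ E), b.
split=> [ts|pre post tw].
  case: qt; rewrite ts; first by case.
  by case: (p.2) => [|? ?|?|?] [//|[r [a //]]].
case: qt; rewrite tw; first by case=> -> ->; right; exists pre, post.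
case: (p.2) => [|pr po|s|x] [//|]; try by case=> r [a].
- by left.
- by move=> [a [-> -> _]]; right; exists pr, (a :: post).
Qed.

Lemma extended_walk_step (p p' : state N) w pre' post' : weak_path p w p' ->
  p'.2 = Walk pre' post' -> p.2 = Start \/
  exists pre post, p.2 = Walk pre post /\ size post = size w + size post'.
Proof.
move=> pp'; elim: pp' => {p p' w} [p|p t u w pt tu IH|p t u a w pt tu IH] pw.
  by right; exists pre', post'.
all: have [ts tw] := extended_walk_trans pt.
all: case: (IH pw) => [/ts|[pre [post [/tw h sz]]]]; first by left.
all: by case: h => [|[pr [po [-> szp]]]]; [left|right; exists pr, po; rewrite szp sz].
Qed.

(** A path that reaches neither [Plain] nor [Extra] would walk forever, but every letter shown
    shortens the committed word. *)
Lemma extended_Inf xi : Inf N xi -> Inf L xi \/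
  exists i (m : nat -> state M) (x : nat -> ext E),
    weak_path (init N) (mkseq xi i) (m 0, Extra (x 0)) /\
    forall k, weak_path ((m k, Extra (x k)) : state N) [:: xi (i + k)] (m k.+1, Extra (x k.+1)).
Proof.
move=> /weak_inf_path_steps[q q0 qP].
have pre n : weak_path (init N) (mkseq xi n) (q n).
  elim: n => [|n IH]; first by rewrite q0; apply: weak_nil.
  by rewrite mkseqS -cats1; apply: weak_cat IH (qP n).
have [[i [s qi]]|nplain] := pselect (exists i s, (q i).2 = Plain s).
  left; have [r _] := extended_consistent (pre i); rewrite qi => -[Ls _].
  apply: (weak_inf_path_prefix Ls).
  apply: (weak_inf_path_coind (P := fun t k => (q (i + k)).2 = Plain t)).
    by rewrite addn0.
  by move=> t k qt; have [t' qt' tt'] := extended_plain (qP (i + k)) qt; exists t'; rewrite ?addnS.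
have [[i [y qi]]|nextra] := pselect (exists i x, (q i).2 = Extra x).
  right; exists i.
  have /choice[x xP] : forall k, exists x, (q (i + k)).2 = Extra x.
    elim=> [|k [x qx]]; first by exists y; rewrite addn0.
    case: (extended_extra_step (qP (i + k)) qx) => -[z qz].
      by case: nplain; exists (i + k).+1, z.
    by exists z; rewrite addnS.
  have qE k : q (i + k) = ((q (i + k)).1, Extra (x k)) by rewrite -xP -surjective_pairing.
  exists (fun k => (q (i + k)).1), x; split; first by rewrite -qE addn0; apply: pre.
  by move=> k; rewrite -!qE addnS; apply: qP.
have walk n : exists pr po, (q n.+1).2 = Walk pr po.
  have [r _] := extended_consistent (pre n.+1).
  case E' : ((q n.+1).2) => [|pr po|s|x].
  - by rewrite mkseqS => -[]; case: (mkseq _ _).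
  - by exists pr, po.
  - by case: nplain; exists n.+1, s.
  - by case: nextra; exists n.+1, x.
have [pr [po q1]] := walk 0.
have dec n : exists pr' po', (q n.+1).2 = Walk pr' po' /\ size po = n + size po'.
  elim: n => [|n [pr' [po' [qn sz]]]]; first by exists pr, po.
  have [pr2 [po2 qn2]] := walk n.+1; exists pr2, po2; split=> //.
  case: (extended_walk_step (qP n.+1) qn2) => [|[? [? []]]]; rewrite qn //.
  by move=> [_ <-] sz2; rewrite sz sz2 addSnnS.
by have [? [? [_ /eqP]]] := dec (size po).+1; rewrite addSn -addnS -{1}[size po]addn0 eqn_add2l.
Qed.

Lemma extended_Inf_sub : Inf L `<=` Inf N.
Proof.
move=> xi /weak_inf_path_steps[q q0 qP].
apply: (weak_inf_path_prefix (n := 0) (t := ((init M, Plain (q 0)) : state N))).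
  by rewrite q0; apply: extended_start.
apply: (weak_inf_path_steps_rev (L := N) (q := fun i => (init M, Plain (q i)))) => i.
exact: extended_plain_lift.
Qed.

End Extended.

(** * Adding stable failures *)

Section BoundedExtension.
Variables (Act : Type) (L : LTS Act) (E : extension L) (U : set Act) (M : LTS Act).
Variable used : ext E -> seq Act -> Prop.
Hypothesis snd : sound (Div M) U used.
Variable h : ext E -> nat.
Hypothesis h_step : forall x a x', ext_step x a x' -> h x' < h x.
Hypothesis h_joint : forall x a x', ext_joint x a x' -> h x' < h x.
Hypothesis h_hide : forall x a x', ext_hide x a x' -> h x' <= h x.
Local Notation N := (extended E U M).

Lemma extended_bounded (p p' : state N) w x x' : weak_path p w p' ->
  p.2 = Extra x -> p'.2 = Extra x' -> size w + h x' <= h x.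
Proof.
move=> pp'; elim: pp' x => {p p' w} [p|p t u w pt tu IH|p t u a w pt tu IH] x px ux.
- by move: ux; rewrite px => -[->].
- case: (extended_extra_trans pt px) => [[s]|[y ty]].
    by move/(extended_plain tu) => [s']; rewrite ux.
  apply: leq_trans (IH _ ty ux) _.
  move: pt; rewrite /= /controlled_trans px ty.
  by case=> [[_ [->]]|[_ []//]|[b _ /h_hide]].
- case: (extended_extra_trans pt px) => [[s]|[y ty]].
    by move/(extended_plain tu) => [s']; rewrite ux.
  rewrite /= addSn; apply: leq_ltn_trans (IH _ ty ux) _.
  move: pt; rewrite /= /controlled_trans px ty.
  by case=> _ [[_ [b _ /h_step]]|[b [_ _ /h_joint]]].
Qed.

Lemma extended_bounded_Inf : Inf N = Inf L.
Proof.
apply/seteqP; split; last exact: extended_Inf_sub.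
move=> xi /(extended_Inf snd)[//|[i [m [x [_ qP]]]]].
suff H n : n + h (x n) <= h (x 0).
  by have := leq_trans (leq_addr _ _) (H (h (x 0)).+1); rewrite ltnn.
elim: n => // n; apply: leq_trans; rewrite addSnnS leq_add2l.
exact: (extended_bounded (qP n) erefl erefl).
Qed.

End BoundedExtension.

(** For such [L] an extra state may be stable at a divergent trace, whatever it refuses, without
    adding a failure. *)
Definition div_saturated (Act : Type) (L : LTS Act) : Prop :=
  forall w X, Div L w -> X `<=` alphabet L -> Sf L (w, X).

Section Closures.
Variables (Act : Type) (R : LTS Act -> LTS Act -> Prop).
Hypothesis (Act_infinite : infinite_set [set: Act]) (R_congruence : congruence R).
Hypothesis R_CFFD : forall L L' : LTS Act, CFFD L L' -> R L L'.

Lemma extended_congr (L : LTS Act) (E : extension L) U M1 M2 :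
  alphabet M1 = alphabet M2 -> R M1 M2 -> R (extended E U M1) (extended E U M2).
Proof. exact: controlled_congr. Qed.

Section DivergenceFailures.
Variables (c : Act) (L : LTS Act).

(* The controlled system is [c.V] or [c.B], released by [c] when the trace built
   so far is already in [Div L]. *)
Definition divergence_extension : extension L :=
  @Extension Act L (bool * seq Act) snd (fun x => ~~ x.1)
    (fun x => x.1 = false /\ Div L x.2)
    (fun _ _ _ => False)
    (fun x a x' => [/\ x.1 = false, a = c & x' = (true, x.2)])
    (fun _ _ _ => False)
    (fun _ _ _ => False).

Definition divergence_used (x : bool * seq Act) (r : seq Act) : Prop :=
  Div L x.2 /\ r = if x.1 then [:: c] else [::].

Lemma divergence_sound (M : LTS Act) :
  @sound _ _ divergence_extension (Div (pref c M)) set0 divergence_used.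
Proof.
split=> //=; first exact: pref_Div_nil.
- by move=> [b w] /= [-> ?].
- by move=> [b w] a _ r /= [-> -> ->] [? /= ->].
- by move=> [b w] r [].
Qed.

Let N (M : LTS Act) := extended divergence_extension set0 (pref c M).

Lemma divergence_extended_Inf M : Inf (N M) = Inf L.
Proof.
by apply: (extended_bounded_Inf (divergence_sound M) (h := fun=> 0)).
Qed.

(** No extra state is stable: before the release the hidden [c] is enabled, afterwards [V] loops. In
    contrast, [B] can reach its stable state, where nothing at all is offered. *)
Lemma divergence_extended_V_Sf : Sf (N (V Act)) = Sf L.
Proof.
apply/seteqP; split=> f; rewrite (extended_Sf (divergence_sound _)); last by left.
case=> // -[_ [m [[b w] [wp _ stab]]]].
have [_ [r rm [_ /= rE]]] := extended_extra (divergence_sound _) wp.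
case: b rE wp stab => /= rE wp stab; move: rm; rewrite rE => /pref_weak_path_init.
  case=> [[]//|[w' [t [_ mt _]]]].
  by case: (stab (Some t, Extra (E := divergence_extension) (true, w))); apply: Or31; rewrite mt.
case=> [[_ mE]|[? [? []//]]]; subst m.
case: (stab (Some tt, Extra (E := divergence_extension) (true, w))).
by apply: Or33; exists c.
Qed.

Lemma divergence_extended_B_Sf f :
  Sf (N (B Act)) f <-> Sf L f \/ f.2 `<=` alphabet L /\ Div L f.1.
Proof.
rewrite (extended_Sf (divergence_sound _)); split=> -[fL|[fA H]]; try by left.
  right; split=> //; have [m [x [wp _ _]]] := H.
  by have [<- [r _ []]] := extended_extra (divergence_sound _) wp.
right; split=> //; exists (Some true), (true, f.1); split.
- have entry := extended_entry set0 (pref c (B Act)) (E := divergence_extension)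
    (x := (false, f.1)) (Div_traces H) (conj erefl H).
  rewrite -[X in weak_path _ X _]cats0; apply: weak_cat entry _.
  apply: (@weak_tau _ (N (B Act)) _ (Some false, Extra (E := divergence_extension) (true, f.1))).
    by apply: Or33; exists c.
  apply: (@weak_tau _ (N (B Act)) _ (Some true, Extra (E := divergence_extension) (true, f.1))).
    exact: Or31.
  exact: weak_nil.
- move=> a fa [m q] [_ [[_]|[b []//]]]; case: q => //= x.
  by case.
- move=> [m q]; case=> /= [[]|[_]|[a]]; first by case: m => // x [].
    by case: q => //= x [].
  by case: m => // x [].
Qed.

End DivergenceFailures.

Lemma divergence_closure (L : LTS Act) : R (V Act) (B Act) ->
  exists L', [/\ R L L', alphabet L' = alphabet L, Div L' = Div L,
    Inf L' = Inf L
    & forall f, Sf L' f <-> Sf L f \/ f.2 `<=` alphabet L /\ Div L f.1].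
Proof.
move=> VB; have [c _] := inhabited_act Act_infinite.
exists (extended (divergence_extension c L) set0 (pref c (B Act))); split=> //.
- apply: (congr_trans R_congruence (L' := extended (divergence_extension c L) set0 (pref c (V Act)))).
    apply: R_CFFD; split=> //.
    + by rewrite divergence_extended_V_Sf.
    + by rewrite (extended_Div (divergence_sound _ _ _)).
    + by rewrite divergence_extended_Inf.
  by apply: extended_congr => //; apply: congr_pref.
- exact: extended_Div (divergence_sound _ _ _).
- exact: divergence_extended_Inf.
- exact: divergence_extended_B_Sf.
Qed.

(** * Refusing the actions that lead to divergent traces *)

Inductive refusal_state (S : Type) : Type :=
  | Await of seq Act & S & nat
  | Released of seq Act & S
  | Absorbed of seq Act.

Section RefusalExtension.
Variables (L : LTS Act) (D : set (seq Act)) (rho : seq Act) (A0 : set Act).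
Hypothesis L_sat : div_saturated L.
Hypothesis D_take : forall i, ~ D (take i rho).
Implicit Types (s : state L) (x : refusal_state (state L)).

(** [Await w s j] holds [L] in the stable state [s] after [w] while the system has performed [j]
    letters of [rho]. At the end of [rho], an action [a] of [A0] is detected in one of two ways. If
    [rcons rho a] is nondivergent, hiding [a] leads to [Released], which silently returns to [s]; so
    the waiting state is unstable. If it is divergent, hiding [a] could create a divergence at [w];
    it is shown instead as any [b] for which [rcons w b] is already in [Div L]. If no action of [A0]
    occurs, letters leading to divergence are refused and the others behave as in [s]. The successor
    in the rank pays for the hidden move to [Released]. *)
Definition refusal_extension : extension L :=
  @Extension Act L (refusal_state (state L))
    (fun x => match x with Await w _ _ => w | Released w _ => w | Absorbed w => w end)
    (fun x => if x is Await _ _ j then (size rho - j).+1 else 0)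
    (fun x => exists w s, [/\ x = Await w s 0, weak_path (init L) w s &
       forall s', ~ trans s None s'])
    (fun _ _ _ => False)
    (fun x a x' => exists w s,
       (exists j, [/\ x = Await w s j, j < size rho, a = nth a rho j &
          x' = Await w s j.+1]) \/
       [/\ x = Await w s (size rho), A0 a, ~ D (rcons rho a) & x' = Released w s])
    (fun x b x' => exists w s, [/\ x = Await w s (size rho), Div L (rcons w b) &
       x' = Absorbed (state L) (rcons w b)])
    (fun x l s' => exists w s,
       [/\ l = None, s' = s & x = Released w s \/
          exists2 j, j < size rho & x = Await w s j] \/
       exists b, [/\ l = Some b, x = Await w s (size rho), ~ Div L (rcons w b) &
          trans s (Some b) s']).

Definition refusal_trigger : set Act := [set a | A0 a /\ D (rcons rho a)].

Definition refusal_used x (r : seq Act) : Prop :=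
  match x with
  | Await w s j => [/\ r = take j rho, j <= size rho, weak_path (init L) w s &
      forall s', ~ trans s None s']
  | Released w s => ~ D r /\ weak_path (init L) w s
  | Absorbed w => Div L w
  end.

Lemma refusal_sound :
  @sound _ _ refusal_extension D refusal_trigger refusal_used.
Proof.
split=> //=.
- by rewrite -(take0 rho).
- by move=> _ [w [s [-> ws stab]]]; split; rewrite // take0.
- move=> x a x' r [w [s [[j [-> jn an ->]]|[-> Aa nDa ->]]]] /= [-> jr ws stab].
    split=> //; first by split=> //; rewrite (take_nth a) // -an.
    by rewrite ltnS ltn_sub2l.
  by split=> //; split=> //; rewrite take_size.
- by move=> x a b x' r [w [s [-> Db ->]]].
- move=> x l s' r [w [s [[-> -> [->|[j _ ->]]]|[b [-> -> nDb ss']]]]] /=.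
  + by rewrite cats0.
  + by rewrite cats0 => -[-> _ ws _].
  + by move=> [-> _ ws _]; split=> //; apply: weak_rcons ws ss'.
- by case=> [w s j|w s|w] r /= => [[-> _ _ _] /D_take|[]|].
Qed.

Lemma refusal_extended_Inf (M : LTS Act) : Div M = D ->
  Inf (extended refusal_extension refusal_trigger M) = Inf L.
Proof.
move=> MD; have := refusal_sound; rewrite -MD => snd.
apply: (extended_bounded_Inf snd
  (h := fun x => if x is Absorbed _ then 0 else 1)) => //.
  by move=> x a x' [w [s [-> _ ->]]].
by move=> x a x' [w [s [[j [-> _ _ ->]]|[-> _ _ ->]]]].
Qed.

(** Only [Absorbed] and [Await] at the end of [rho] can be stable, all other extra states having a
    silent exit. Failures of [Absorbed] belong to [L] by saturation; the second alternative records
    what stability of [Await] says about the system. *)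
Lemma refusal_extra_failure (M : LTS Act) f : Div M = D ->
  extra_failure refusal_extension refusal_trigger M f ->
  Sf L f \/ exists m s, [/\ weak_path (init M) rho m,
    forall m', ~ trans m None m',
    forall a, A0 a -> ~ D (rcons rho a) -> forall m', ~ trans m (Some a) m',
    Sf L (f.1, f.2 `&` [set a | ~ Div L (rcons f.1 a)]) &
    forall a m', refusal_trigger a -> trans m (Some a) m' ->
      f.2 `<=` [set b | ~ Div L (rcons f.1 b)]].
Proof.
move=> MD; have := refusal_sound; rewrite -MD => snd.
move=> [fA [m [x [wp ref stab]]]].
have [xw [r rm xr]] := extended_extra snd wp.
case: x xw xr wp ref stab => [w s j|w s|w] /= xw xr wp ref stab; subst w.
- have [rE jr ws sstab] := xr.
  move: jr; rewrite leq_eqVlt => /orP[/eqP jr|jr]; last first.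
    case: (stab (m, Plain s)); apply: Or32; split=> //=.
    by exists f.1, s; left; split=> //; right; exists j.
  move: rm rE => rm; rewrite jr take_size => rE; subst r j.
  right; exists m, s; split=> //.
  + by move=> m' mm'; apply: (stab (m', Extra (E := refusal_extension) (Await f.1 s (size rho)))); apply: Or31.
  + move=> a Aa nDa m' mm'; apply: (stab (m', Extra (E := refusal_extension) (Released f.1 s))); apply: Or33.
    by exists a => //; exists f.1, s; right; split=> //; rewrite -MD.
  + split=> [a [] /fA //|]; exists s; split=> // a [/= fa nDa] s' ss'.
    apply: (ref a fa (m, Plain s')); split; first exact: fA.
    by left; split=> //=; exists f.1, s; right; exists a.
  + move=> a m' Ua mm' b fb Db; apply: (ref b fb (m', Extra (E := refusal_extension) (Absorbed (state L) (rcons f.1 b)))).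
    split; first exact: fA.
    by right; exists a; split=> //; exists f.1, s.
- case: (stab (m, Plain s)); apply: Or32; split=> //=.
  by exists f.1, s; left; split=> //; left.
- by left; rewrite [f]surjective_pairing; apply: L_sat.
Qed.

End RefusalExtension.

Lemma refusal_closure (L M1 M2 : LTS Act) rho A0 :
  div_saturated L -> R M1 M2 -> alphabet M1 = alphabet M2 -> Div M1 = Div M2 ->
  Sf M1 (rho, A0) -> ~ Sf M2 (rho, A0) -> (forall i, ~ Div M1 (take i rho)) ->
  exists L', [/\ R L L', alphabet L' = alphabet L, Div L' = Div L,
    Inf L' = Inf L
    & forall f, Sf L' f <-> f.2 `<=` alphabet L /\
        Sf L (f.1, f.2 `&` [set a | ~ Div L (rcons f.1 a)])].
Proof.
move=> L_sat R12 A12 D12 M1f M2f D_take.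
have [D D1 D2] : exists2 D, Div M1 = D & Div M2 = D by exists (Div M1).
rewrite D1 in D_take.
pose E := refusal_extension L D rho A0; pose U := refusal_trigger D rho A0.
have snd M : Div M = D -> @sound _ _ E (Div M) U (refusal_used (L := L) D rho).
  by move=> ->; apply: refusal_sound.
have snd1 := snd _ D1; have snd2 := snd _ D2.
exists (extended E U M1); split=> //.
- apply: (congr_trans R_congruence (L' := extended E U M2)); last first.
    by apply: extended_congr => //; apply: congr_sym.
  apply: R_CFFD; split=> //.
  + apply/seteqP; split=> f; rewrite (extended_Sf snd2); first by left.
    case=> // /(refusal_extra_failure L_sat D_take D2)[//|].
    move=> [m [s [rm stab nD Lf fU]]].
    (* [M2] lacks the failure [(rho, A0)], so it offers some [a] of [A0] in [m]. By [nD],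
       [rcons rho a] is divergent; the joint move then offers every letter leading to divergence,
       and [f.2] contains none of these. *)
    have [a [Aa [m' mm']]] : exists a, A0 a /\ exists m', trans m (Some a) m'.
      apply: contrapT => H; apply: M2f; split; first by rewrite -A12; case: M1f.
      by exists m; split=> // a Aa m' mm'; apply: H; exists a; split=> //; exists m'.
    have Ua : U a.
      by split=> //; apply: contrapT => nDa; apply: nD mm'.
    suff fE : f.2 `&` [set a | ~ Div L (rcons f.1 a)] = f.2.
      by rewrite fE -surjective_pairing in Lf.
    by apply/seteqP; split=> [b []//|b fb]; split=> //; apply: fU fb; eassumption.
  + by rewrite (extended_Div snd2).
  + by rewrite (refusal_extended_Inf L A0 D_take D2).
- exact: extended_Div snd1.
- exact: (refusal_extended_Inf L A0 D_take D1).
move=> f; rewrite (extended_Sf snd1); split.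
  have sub (g : seq Act * set Act) (X : set Act) : Sf L g -> Sf L (g.1, g.2 `&` X).
    move=> [gA [s [ws ref stab]]]; split; first by move=> a [/gA].
    by exists s; split=> // a [/ref].
  case=> [Lf|ef]; first by split; [case: Lf|exact: sub].
  case: (ef) => fA _; split=> //.
  by case: (refusal_extra_failure L_sat D_take D1 ef) => [/sub//|[m [s []]]].
(* [M1] is driven to a stable state refusing [A0], where neither detection can occur. *)
move=> [fA [_ [s [ws ref stab]]]]; right; split=> //.
have [_ [m [rm mref mstab]]] := M1f.
exists m, (Await f.1 s (size rho)); split.
- rewrite -[X in weak_path _ X _]cats0.
  have entry := extended_entry U M1 (E := E) (x := Await f.1 s 0).
  apply: (weak_cat (entry _ _)); first by exists s.
    by exists f.1, s.
  have [a0 _] := inhabited_act Act_infinite.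
  apply: (controlled_run _ _ (K := extension_controller E) (M := M1)
    (g := fun j => Extra (E := E) (Await f.1 s j)) (xi := nth a0 rho) (i := 0)
    (n := size rho)).
    move=> j /andP[_ jr] /=; exists f.1, s; left; exists j; split=> //.
    exact: set_nth_default.
  by rewrite -/(mkseq _ _) mkseq_nth.
- move=> a fa [m' q] [_ [[_]|[b [[Ab Db] mm' _]]]]; last exact: mref mm'.
  case: q => //= [s'|x [//]] [w [s0 [[//]|[b [[<-] [<- <-] nDb ss']]]]].
  exact: ref ss'.
- move=> [m' q]; case=> /= [[/mstab]|[_]|[a mm']] //.
    case: q => //= [s'|x []//] [w [s0 [[_ _ [//|[j jr [_ _ je]]]]|[b []//]]]].
    by rewrite -je ltnn in jr.
  case: q => //= x [w [s0 [[j [[_ _ <-]]]|[[<- <-] Aa _ _]]]]; first by rewrite ltnn.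
  exact: mref mm'.
Qed.

End Closures.

(** * Adding infinite traces *)

Lemma subn_telescope a b c : a <= b -> b <= c -> c - a = (b - a) + (c - b).
Proof. by move=> ab bc; rewrite addnC addnBA // subnK. Qed.

Section InfiniteTraceExtension.
Variables (Act : Type) (L : LTS Act) (D : set (seq Act)) (chi : nat -> Act).
Variable T : set (nat -> Act).
Hypothesis L_sat : div_saturated L.
Hypothesis D_nil : ~ D [::].

(* While the first [i] letters of [zeta] have been shown, the controlled system
   moves along [chi] from position [k i] to position [k i.+1]. *)
Definition schedule (zeta : nat -> Act) (k : nat -> nat) : Prop :=
  [/\ k 0 = 0, forall i, k i <= k i.+1, forall n, exists i, n <= k i,
      forall i j, k i <= j <= k i.+1 -> D (mkseq chi j) -> Div L (mkseq zeta i)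
    & forall i, traces L (mkseq zeta i)].

Record chain_state := Chain {
  chain_target : nat -> Act;
  chain_schedule : nat -> nat;
  chain_shown : nat;
  chain_done : nat }.

(** A letter is shown when the system has reached the position scheduled for it. The silent return
    to [L] exists exactly at nondivergent prefixes of [chi]. At divergent ones the schedule makes
    the shown word a divergence of [L], so the composite may diverge there or, by saturation, be
    stable. *)
Definition chain_extension : extension L :=
  @Extension Act L chain_state
    (fun x => mkseq (chain_target x) (chain_shown x))
    (fun x => chain_schedule x (chain_shown x).+1 - chain_done x)
    (fun x => exists zeta k, [/\ x = Chain zeta k 0 0, T zeta & schedule zeta k])
    (fun x a x' => exists zeta k i,
       [/\ x = Chain zeta k i (k i.+1), a = zeta i & x' = Chain zeta k i.+1 (k i.+1)])
    (fun x a x' => exists zeta k i j,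
       [/\ x = Chain zeta k i j, j < k i.+1, a = chi j & x' = Chain zeta k i j.+1])
    (fun _ _ _ => False)
    (fun x l s => [/\ l = None, ~ D (mkseq chi (chain_done x)) &
       weak_path (init L) (mkseq (chain_target x) (chain_shown x)) s]).

Definition chain_used (x : chain_state) (r : seq Act) : Prop :=
  [/\ r = mkseq chi (chain_done x), T (chain_target x),
      schedule (chain_target x) (chain_schedule x)
    & chain_schedule x (chain_shown x) <= chain_done x
        <= chain_schedule x (chain_shown x).+1].

Lemma chain_sound : @sound _ _ chain_extension D set0 chain_used.
Proof.
split=> //=.
- by move=> _ [zeta [k [-> Tz sk]]]; split=> //=; have [-> _ _ _ _] := sk.
- move=> x a x' r [zeta [k [i [-> -> ->]]]] [/= -> Tz sk _]; split; last exact: mkseqS.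
  by split=> //=; have [_ kS _ _ _] := sk; rewrite leqnn kS.
- move=> x a x' r [zeta [k [i [j [-> jk -> ->]]]]] [/= -> Tz sk /andP[kj _]].
  split=> //=; first by split=> //=; [rewrite mkseqS|rewrite jk leqW].
  by rewrite ltn_sub2l.
- by move=> x l s r [-> nD Ls] [-> _ _ _]; rewrite cats0.
- by move=> x r [-> _ [_ _ _ dk _] kj] /dk; apply.
Qed.

Section Controlled.
Variable M : LTS Act.
Hypothesis MD : Div M = D.
Local Notation N := (extended chain_extension set0 M).
Local Notation XChain z k i j := (Extra (E := chain_extension) (Chain z k i j)).

Let snd : @sound _ _ chain_extension (Div M) set0 chain_used.
Proof. by rewrite MD; apply: chain_sound. Qed.

Lemma chain_Div : Div N = Div L.
Proof. exact: extended_Div snd. Qed.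

Lemma chain_Sf : Sf N = Sf L.
Proof.
apply/seteqP; split=> f; rewrite (extended_Sf snd); first last; first by left.
case=> // -[fA [m [x [wp ref stab]]]].
have [xw [r rm [rE Tx [_ _ _ dk tr] kx]]] := extended_extra snd wp.
have [/dk/(_ )Dx|nDx] := pselect (D (mkseq chi (chain_done x))).
  by rewrite [f]surjective_pairing; apply: L_sat => //; rewrite -xw; apply: Dx kx.
have [s Ls] := tr (chain_shown x).
by case: (stab (m, Plain s)); apply: Or32.
Qed.

Lemma chain_path (p p' : state N) w x x' : weak_path p w p' ->
  p.2 = Extra x -> p'.2 = Extra x' ->
  [/\ chain_target x' = chain_target x, chain_schedule x' = chain_schedule x,
      chain_done x <= chain_done x'
    & weak_path p.1 [seq chi j | j <- iota (chain_done x) (chain_done x' - chain_done x)] p'.1].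
Proof.
move=> pp'; elim: pp' x => {p p' w} [p|p t u w pt tu IH|p t u a w pt tu IH] x px ux.
- by move: ux; rewrite px => -[->]; rewrite subnn; split=> //; apply: weak_nil.
- case: (extended_extra_trans pt px) => [[s]|[y ty]].
    by move/(extended_plain tu) => [s']; rewrite ux.
  have [ty1 ty2 yx tx] := IH _ ty ux; move: pt; rewrite /= /controlled_trans px ty.
  case=> [[pt1 [->]]|[_ []//]|[b pt1 [zeta [k [i [j [xE jk bE yE]]]]]]].
    by split=> //; apply: weak_tau pt1 tx.
  rewrite ty1 ty2; move: yx tx; rewrite xE yE /= => jx tx; split=> //; first exact: ltnW.
  rewrite -(subnSK jx) /=.
  by apply: weak_vis tx; rewrite -bE.
- case: (extended_extra_trans pt px) => [[s]|[y ty]].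
    by move/(extended_plain tu) => [s']; rewrite ux.
  have [ty1 ty2 yx tx] := IH _ ty ux; move: pt; rewrite /= /controlled_trans px ty.
  case=> _ [[pt1 [b _ [zeta [k [i [xE _ yE]]]]]]|[b [//]]].
  by rewrite ty1 ty2; move: yx tx; rewrite xE yE /= pt1.
Qed.

(* Staying in the chain forever forces the controlled system through [chi]. *)
Lemma chain_Inf xi : Inf N xi -> Inf L xi \/ T xi /\ Inf M chi.
Proof.
move=> /(extended_Inf snd)[|[i [m [x [wp qP]]]]]; first by left.
have wpn n : weak_path (init N) (mkseq xi (i + n)) (m n, Extra (x n)).
  elim: n => [|n IH]; first by rewrite addn0.
  by rewrite addnS mkseqS -cats1; apply: weak_cat IH (qP n).
have ext n := extended_extra snd (wpn n).
have shown n : chain_shown (x n) = i + n.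
  by have [/= + _] := ext n => /(congr1 size); rewrite !size_mkseq.
have step n := chain_path (qP n) erefl erefl.
have target n : chain_target (x n) = chain_target (x 0).
  by elim: n => // n <-; have [] := step n.
have sched n : chain_schedule (x n) = chain_schedule (x 0).
  by elim: n => // n <-; have [] := step n.
set k := chain_schedule (x 0) in sched.
right; split.
  have [_ [_ _ [_ T0 _ _]]] := ext 0; suff <- : chain_target (x 0) = xi by [].
  apply/funext => j; have [/= + _] := ext j.+1; rewrite shown target => /(congr1 (nth (xi j) ^~ j)).
  by rewrite !nth_mkseq ?addnS ?ltnS ?leq_addl.
have far n : exists2 n', n <= n' & chain_done (x n) < chain_done (x n').
  have [_ [_ _ [_ _ [_ kS kunb _ _] _]]] := ext 0.
  have kmono : {homo k : a b / a <= b} by exact: (homo_leq leqnn leq_trans kS).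
  have [i' ki'] := kunb (chain_done (x n)).+1.
  exists (n + i'); first exact: leq_addr.
  apply: leq_trans ki' _; have [_ [_ _ [_ _ _ /andP[+ _]]]] := ext (n + i').
  by rewrite shown sched; apply: leq_trans; apply: kmono; rewrite addnA leq_addl.
have steps n n' : n <= n' -> chain_done (x n) <= chain_done (x n') /\
    weak_path (m n) [seq chi j | j <- iota (chain_done (x n)) (chain_done (x n') - chain_done (x n))] (m n').
  move=> /subnKC <-; elim: (n' - n) => [|d [le IH]].
    by rewrite addn0 subnn; split=> //; apply: weak_nil.
  rewrite addnS; have [_ _ le' st] := step (n + d); split; first exact: leq_trans le'.
  rewrite (subn_telescope le le').
  by rewrite iotaD map_cat subnKC //; apply: weak_cat IH st.
apply: (weak_inf_path_coind (P := fun t j => exists n, j <= chain_done (x n) /\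
    weak_path t [seq chi j' | j' <- iota j (chain_done (x n) - j)] (m n))).
  exists 0; split=> //; have [_ [r rm [rE _ _ _]]] := ext 0.
  by rewrite subn0; rewrite rE in rm.
move=> t j [n [jn tm]].
have [n' [jn' tm']] : exists n', j < chain_done (x n') /\
    weak_path t [seq chi j' | j' <- iota j (chain_done (x n') - j)] (m n').
  have [n' nn' lt] := far n; exists n'; split; first exact: leq_ltn_trans lt.
  have [le st] := steps n n' nn'.
  rewrite (subn_telescope jn le).
  by rewrite iotaD map_cat subnKC //; apply: weak_cat tm st.
move: tm'; rewrite -(subnSK jn') /= -cat1s => /weak_split[u tu um].
by exists u => //; exists n'.
Qed.

Lemma chain_Inf_add zeta k : Inf M chi -> T zeta -> schedule zeta k -> Inf N zeta.
Proof.
move=> /weak_inf_path_steps[q q0 qP] Tz sk; have [k0 kS _ _ tr] := sk.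
have run j d : weak_path (q j) [seq chi i | i <- iota j d] (q (j + d)).
  elim: d => [|d IH]; first by rewrite addn0; apply: weak_nil.
  by rewrite addnS -[d.+1]addn1 iotaD map_cat; apply: weak_cat IH (qP (j + d)).
apply: (weak_inf_path_prefix (n := 0) (t := ((q (k 0), XChain zeta k 0 (k 0)) : state N))).
  rewrite k0 q0; apply: (extended_entry set0 M (E := chain_extension) (x := Chain zeta k 0 0)).
    exact: (tr 0).
  by exists zeta, k.
apply: (weak_inf_path_steps_rev (L := N)
  (q := fun i => (q (k i), XChain zeta k i (k i)))) => i.
apply: (@weak_cat _ N _ (q (k i.+1), XChain zeta k i (k i.+1)) _ [::]).
  have := controlled_run (alphabet L) set0 (K := extension_controller chain_extension)
    (g := fun j => XChain zeta k i j) _ (run (k i) (k i.+1 - k i)).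
  rewrite subnKC //; apply => j /andP[_ jk].
  by exists zeta, k, i, j.
apply: (@weak_vis _ N _ (q (k i.+1), XChain zeta k i.+1 (k i.+1))); last exact: weak_nil.
split; last by left; split=> //; exists (zeta i) => //; exists zeta, k, i.
have [s] := tr i.+1; rewrite mkseqS -cats1 => /weak_split[t _]; exact: weak_path_alphabet.
Qed.

End Controlled.
End InfiniteTraceExtension.

Section InfiniteTraceClosure.
Variables (Act : Type) (R : LTS Act -> LTS Act -> Prop).
Hypothesis (Act_infinite : infinite_set [set: Act]) (R_congruence : congruence R).
Hypothesis R_CFFD : forall L L' : LTS Act, CFFD L L' -> R L L'.

(** A single [chi] serves all of [T]: the letters shown are those of the target, while [chi] only
    supplies moves that [M1] can continue forever and [M2] cannot. *)
Lemma infinite_trace_closure (L M1 M2 : LTS Act) chi (T : set (nat -> Act)) :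
  div_saturated L -> R M1 M2 -> alphabet M1 = alphabet M2 -> Div M1 = Div M2 ->
  ~ Div M1 [::] -> Inf M1 chi -> ~ Inf M2 chi ->
  (forall zeta, T zeta -> exists k, schedule L (Div M1) chi zeta k) ->
  exists L', [/\ R L L', alphabet L' = alphabet L, Div L' = Div L,
    Sf L' = Sf L & Inf L' = Inf L `|` T].
Proof.
move=> L_sat R12 A12 D12 D_nil M1c M2c TP.
have [D D1 D2] : exists2 D, Div M1 = D & Div M2 = D by exists (Div M1).
rewrite D1 in D_nil TP.
pose N M := extended (chain_extension L D chi T) set0 M.
exists (N M1); split=> //.
- apply: (congr_trans R_congruence (L' := N M2)); last first.
    by apply: controlled_congr => //; apply: congr_sym.
  apply: R_CFFD; split=> //.
  + by rewrite (chain_Sf _ _ L_sat D_nil D2).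
  + by rewrite (chain_Div _ _ _ D_nil D2).
  + apply/seteqP; split; first exact: extended_Inf_sub.
    by move=> xi /(chain_Inf D_nil D2)[|[]].
- exact: (chain_Div _ _ _ D_nil D1).
- exact: (chain_Sf _ _ L_sat D_nil D1).
apply/seteqP; split=> xi.
  by move=> /(chain_Inf D_nil D1)[|[]]; [left|right].
case; first exact: extended_Inf_sub.
by move=> Tx; have [k sk] := TP xi Tx; apply: chain_Inf_add sk.
Qed.

Definition cons_trace (c : Act) (xi : nat -> Act) : nat -> Act :=
  fun i => if i is j.+1 then xi j else c.

Lemma mkseq_cons_trace c xi n : mkseq (cons_trace c xi) n.+1 = c :: mkseq xi n.
Proof. by rewrite /mkseq /= (iotaDl 1 0) -map_comp. Qed.

End InfiniteTraceClosure.

(** * The induced equivalences *)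

Section Schedules.
Variables (Act : Type) (L : LTS Act) (D : set (seq Act)) (chi zeta : nat -> Act).
Hypothesis D_nil : ~ D [::].
Hypothesis zeta_Div : forall n, exists2 i, n <= i & Div L (mkseq zeta i).

Lemma recurrent_Div_traces i : traces L (mkseq zeta i).
Proof.
have [j /subnKC <- /Div_traces] := zeta_Div i.
by rewrite /mkseq iotaD map_cat => /traces_prefix.
Qed.

(** The system rests only at nondivergent prefixes of [chi] and passes to a later one only while the
    shown prefix of [zeta] is divergent, so what lies between is harmless. This happens infinitely
    often, so the schedule is unbounded. *)
Lemma recurrent_schedule :
  (forall n, exists2 j, n <= j & ~ D (mkseq chi j)) -> exists k, schedule L D chi zeta k.
Proof.
move=> chi_D.
have /choice[next nextP] : forall n, exists j, n < j /\ ~ D (mkseq chi j).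
  by move=> n; have [j nj nD] := chi_D n.+1; exists j.
pose k := fix k i := if i is i'.+1 then
  if `[< Div L (mkseq zeta i') >] then next (k i') else k i' else 0.
have kS i : k i <= k i.+1.
  by rewrite /=; case: asboolP => // _; apply/ltnW; case: (nextP (k i)).
have kD i : ~ D (mkseq chi (k i)).
  by elim: i => //= i IH; case: asboolP => // _; case: (nextP (k i)).
exists k; split=> //.
- elim=> [|n [i ni]]; first by exists 0.
  have [j ij Dj] := zeta_Div i; exists j.+1; rewrite /=; case: asboolP => // _.
  have [kj _] := nextP (k j); apply: leq_ltn_trans kj.
  by apply: leq_trans ni _; apply: (homo_leq leqnn leq_trans kS).
- move=> i j; rewrite /=; case: asboolP => // _; rewrite -eqn_leq => /eqP <- /kD //.
- exact: recurrent_Div_traces.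
Qed.

(** The system waits at the empty prefix until [n] letters are shown, whence the truncated
    subtraction; then it makes one step of [chi] per letter, while every shown prefix is
    divergent. *)
Lemma eventual_schedule n : (forall i, n <= i -> Div L (mkseq zeta i)) ->
  exists k, schedule L D chi zeta k.
Proof.
move=> Dn; exists (fun i => i - n); split=> //.
- by move=> i; apply: leq_sub2r.
- by move=> m; exists (n + m); rewrite addKn.
- move=> i j; case: (leqP n i) => [/Dn //|ni] /andP[_].
  by rewrite (eqP (_ : i.+1 - n == 0)) ?subn_eq0 // leqn0 => /eqP ->.
- exact: recurrent_Div_traces.
Qed.

End Schedules.

Lemma not_preserves (Act T : Type) (R : LTS Act -> LTS Act -> Prop) (X : LTS Act -> set T) :
  (forall L L', R L L' -> R L' L) -> ~ preserves R X ->
  exists L L' x, [/\ R L L', X L x & ~ X L' x].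
Proof.
move=> R_sym; apply: contra_notP => H.
have sub L L' : R L L' -> X L `<=` X L'.
  by move=> LL' x Xx; apply: contrapT => nXx; apply: H; exists L, L', x.
by move=> L L' LL'; apply/seteqP; split; apply: sub => //; apply: R_sym.
Qed.

Lemma weak_path_all Act (L : LTS Act) (s t : state L) w :
  weak_path s w t -> all (mem (alphabet L)) w.
Proof.
elim=> {s t w} // s t u a w st _ /= ->; rewrite andbT.
by apply: mem_set; apply: transP st.
Qed.

(** A shortest divergent prefix would be in [minD] and put [w] into [extT]. *)
Lemma anF_take_not_Div Act (L : LTS Act) w X i : anF L (w, X) -> ~ Div L (take i w).
Proof.
move=> [[_ [s [/weak_path_all ws _ _]]] next] Di; apply: next; split=> //.
have ex : exists i, `[< Div L (take i w) >] by exists i; apply/asboolP.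
case: (ex_minnP ex) => j /asboolP Dj jmin.
have jw : j <= size w.
  rewrite leqNgt; apply/negP => wj.
  have := jmin (size w); rewrite take_size leqNgt wj => H.
  by have: false by apply: H; apply/asboolP; move: Dj; rewrite take_oversize // ltnW.
exists j => //; split=> // i' ; rewrite size_takel // => i'j.
rewrite take_takel; last exact: ltnW.
by move=> /asboolP /jmin; rewrite leqNgt i'j.
Qed.

Lemma Sf_snF Act (L : LTS Act) w X : ~ Div L w ->
  Sf L (w, X `&` [set a | ~ Div L (rcons w a)]) <->
  snF L (w, X `&` [set a | ~ Div L (rcons w a)]).
Proof. by move=> nD; split=> [Lw|[[]]//]; split=> // a []. Qed.

Section Induced.
Variables (Act : Type) (R : LTS Act -> LTS Act -> Prop).
Hypothesis (Act_infinite : infinite_set [set: Act]) (R_congruence : congruence R).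
Hypothesis R_CFFD : forall L L' : LTS Act, CFFD L L' -> R L L'.
Hypothesis R_VB : R (V Act) (B Act).
Hypothesis R_snF : preserves R (@snF Act).
Hypothesis R_not_anF : ~ preserves R (@anF Act).

Let R_alphabet L L' : R L L' -> alphabet L = alphabet L'.
Proof. exact: snF_preserves_alphabet. Qed.

Let R_Div L L' : R L L' -> Div L = Div L'.
Proof. exact: snF_preserves_Div. Qed.

Lemma failure_closure L : exists L',
  [/\ R L L', alphabet L' = alphabet L, Div L' = Div L, Inf L' = Inf L
    & forall f, Sf L' f <-> f.2 `<=` alphabet L /\
        (Div L f.1 \/ snF L (f.1, f.2 `&` [set a | ~ Div L (rcons f.1 a)]))].
Proof.
have [L1 [LL1 A1 D1 I1 S1]] :=
  divergence_closure Act_infinite R_congruence R_CFFD L R_VB.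
have sat : div_saturated L1.
  by move=> w X; rewrite D1 A1 => Dw XA; apply/S1; right.
have [M1 [M2 [[rho A0] [M12 M1f nM2f]]]] := not_preserves (congr_sym R_congruence) R_not_anF.
have eA := R_alphabet M12; have eD := R_Div M12.
have nM2 : ~ Sf M2 (rho, A0).
  (* [extT] is determined by the alphabet and [Div], which agree, so a failure of [M1] missing from
     [anF M2] is missing from [Sf M2]. *)
  move=> M2f; apply: nM2f; split=> //; case: M1f => _.
  by rewrite /extT /minD eA eD.
have [L2 [L12 A2 D2 I2 S2]] := refusal_closure Act_infinite R_congruence R_CFFD
  sat M12 eA eD M1f.1 nM2 (fun i => @anF_take_not_Div _ _ _ _ i M1f).
exists L2; split.
- exact: (congr_trans R_congruence LL1 L12).
- by rewrite A2.
- by rewrite D2.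
- by rewrite I2.
move=> f; rewrite S2 A1 D1; split=> -[fA Sf_f]; split=> //.
  have [|nD] := pselect (Div L f.1); [by left|right].
  by apply/Sf_snF => //; move/S1: Sf_f => [|[_]].
apply/S1; case: Sf_f => [Df|[[]]]; last by left.
by right; split=> //= a [/fA].
Qed.

(** [T] takes the divergence set as its only argument, so the same traces are added to [L] and to
    [L']; their closures are then CFFD-equivalent. *)
Lemma induced_of_infinite_closure (T : set (seq Act) -> set (nat -> Act)) L L' :
  (forall L0, div_saturated L0 -> exists L1, [/\ R L0 L1, alphabet L1 = alphabet L0,
     Div L1 = Div L0, Sf L1 = Sf L0 & Inf L1 = Inf L0 `|` T (Div L0)]) ->
  alphabet L = alphabet L' -> snF L = snF L' -> Div L = Div L' ->
  Inf L `|` T (Div L) = Inf L' `|` T (Div L') -> R L L'.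
Proof.
move=> closure eA eF eD eI.
have normal K : exists K', [/\ R K K', alphabet K' = alphabet K, Div K' = Div K,
    Inf K' = Inf K `|` T (Div K)
    & forall f, Sf K' f <-> f.2 `<=` alphabet K /\
        (Div K f.1 \/ snF K (f.1, f.2 `&` [set a | ~ Div K (rcons f.1 a)]))].
  have [K1 [KK1 A1 D1 I1 S1]] := failure_closure K.
  have [|K2 [K12 A2 D2 S2 I2]] := closure K1.
    by move=> w X; rewrite D1 A1 => Dw XA; apply/S1; split=> //; left.
  exists K2; split; rewrite ?A2 ?D2 ?I2 ?S2 ?I1 ?D1 //.
  exact: (congr_trans R_congruence KK1 K12).
have [L1 [LL1 A1 D1 I1 S1]] := normal L.
have [L2 [LL2 A2 D2 I2 S2]] := normal L'.
apply: (congr_trans R_congruence LL1).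
apply: (congr_trans R_congruence (L' := L2)); last exact: congr_sym LL2.
apply: R_CFFD; split; rewrite ?A1 ?A2 ?D1 ?D2 ?I1 ?I2 //.
by apply/seteqP; split=> f; rewrite S1 S2 eA eD eF.
Qed.

(* The prefix [c] makes the empty trace of the witness nondivergent. *)
Lemma prefixed_closure (M1 M2 : LTS Act) chi (T : set (nat -> Act)) L :
  R M1 M2 -> Inf M1 chi -> ~ Inf M2 chi -> div_saturated L ->
  (forall (c : Act) zeta, T zeta ->
     exists k, schedule L (Div (pref c M1)) (cons_trace c chi) zeta k) ->
  exists L1, [/\ R L L1, alphabet L1 = alphabet L,
     Div L1 = Div L, Sf L1 = Sf L & Inf L1 = Inf L `|` T].
Proof.
move=> M12 M1c M2c sat TP; have [c _] := inhabited_act Act_infinite.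
have R12 : R (pref c M1) (pref c M2) by apply: congr_pref.
apply: (infinite_trace_closure Act_infinite R_congruence R_CFFD sat R12
  (R_alphabet R12) (R_Div R12) (@pref_Div_nil _ c M1) _ _ (TP c)).
  exact/pref_Inf.
by move/pref_Inf.
Qed.

Lemma pref_Div_cons_trace c (M : LTS Act) chi n :
  Div (pref c M) (mkseq (cons_trace c chi) n.+1) <-> Div M (mkseq chi n).
Proof. by rewrite mkseq_cons_trace; apply: pref_Div_cons. Qed.

Lemma induced_eanI : ~ preserves R (@aenI Act) ->
  induced_by R (@snF Act) (@Div Act) (@eanI Act).
Proof.
move=> naenI L L'; split=> [LL'|[eA eF eD eI]].
  split; [exact: R_alphabet|exact: R_snF|exact: R_Div|exact: snF_preserves_eanI LL'].
have [M1 [M2 [chi [M12 [M1c rec] nM2c]]]] := not_preserves (congr_sym R_congruence) naenI.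
have M2c : ~ Inf M2 chi by move=> M2c; apply: nM2c; split=> //; rewrite -(R_Div M12).
pose T (D : set (seq Act)) := [set zeta | forall n, exists2 i, n <= i & D (mkseq zeta i)].
apply: (induced_of_infinite_closure (T := T)) => // [L0 sat|].
  apply: (prefixed_closure M12 M1c M2c sat) => c zeta Tz.
  apply: recurrent_schedule => //; first exact: pref_Div_nil.
  move=> n; have [i ni nD] := rec n; exists i.+1; first exact: leqW.
  by rewrite pref_Div_cons_trace.
(* An infinite trace outside [T] has finitely many divergent prefixes and so lies in [eanI]. *)
have IT K : Inf K `|` T (Div K) = eanI K `|` T (Div K).
  apply/seteqP; split=> xi [Kx|]; try by right.
    have [Tx|nT] := pselect (T (Div K) xi); [by right|left; split=> //].
    apply: contrapT => H; apply: nT => n; apply: contrapT => Hn; apply: H.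
    by exists n => i ni Di; apply: Hn; exists i.
  by case: Kx; left.
by rewrite !IT eI eD.
Qed.

Lemma induced_aenI : preserves R (@aenI Act) -> ~ preserves R (@Inf Act) ->
  induced_by R (@snF Act) (@Div Act) (@aenI Act).
Proof.
move=> R_aenI nInf L L'; split=> [LL'|[eA eF eD eI]].
  split; [exact: R_alphabet|exact: R_snF|exact: R_Div|exact: R_aenI].
have [M1 [M2 [chi [M12 M1c M2c]]]] := not_preserves (congr_sym R_congruence) nInf.
(* All prefixes of [chi] except the empty one may diverge after prefixing; [eventual_schedule]
   tolerates this at the price of requiring almost all prefixes of [zeta] to diverge. *)
pose T (D : set (seq Act)) := [set zeta | exists n, forall i, n <= i -> D (mkseq zeta i)].
apply: (induced_of_infinite_closure (T := T)) => // [L0 sat|].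
  apply: (prefixed_closure M12 M1c M2c sat) => c zeta [n Dn].
  apply: (eventual_schedule _ _ _ Dn); first exact: pref_Div_nil.
  by move=> m; exists (maxn n m); [exact: leq_maxr|apply: Dn; exact: leq_maxl].
have IT K : Inf K `|` T (Div K) = aenI K `|` T (Div K).
  apply/seteqP; split=> xi [Kx|]; try by right.
    have [Tx|nT] := pselect (T (Div K) xi); [by right|left; split=> //].
    move=> n; apply: contrapT => H; apply: nT; exists n => i ni.
    by apply: contrapT => nD; apply: H; exists i.
  by case: Kx; left.
by rewrite !IT eI eD.
Qed.

Lemma induced_Inf : preserves R (@Inf Act) ->
  induced_by R (@snF Act) (@Div Act) (@Inf Act).
Proof.
move=> R_Inf L L'; split=> [LL'|[eA eF eD eI]].
  split; [exact: R_alphabet|exact: R_snF|exact: R_Div|exact: R_Inf].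
apply: (induced_of_infinite_closure (T := fun=> set0)) => // [L0 _|].
  by exists L0; split=> //; [exact: congr_refl|rewrite setU0].
by rewrite eI.
Qed.

End Induced.

Theorem theorem7p9 (Act : Type) (Act_infinite : infinite_set [set: Act])
    (R : LTS Act -> LTS Act -> Prop)
    (R_congruence : congruence R)
    (R_CFFD : forall L L' : LTS Act, CFFD L L' -> R L L')
    (R_VB : R (V Act) (B Act)) :
  [/\ preserves R (@snF Act) -> ~ preserves R (@anF Act) ->
        ~ preserves R (@aenI Act) ->
        induced_by R (@snF Act) (@Div Act) (@eanI Act),
      preserves R (@snF Act) -> preserves R (@aenI Act) ->
        ~ preserves R (@anF Act) -> ~ preserves R (@Inf Act) ->
        induced_by R (@snF Act) (@Div Act) (@aenI Act)
    & preserves R (@snF Act) -> preserves R (@Inf Act) ->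
        ~ preserves R (@anF Act) ->
        induced_by R (@snF Act) (@Div Act) (@Inf Act)].
Proof.
split=> [R_snF nanF naenI|R_snF R_aenI nanF nInf|R_snF R_Inf nanF].
- exact: induced_eanI.
- exact: induced_aenI.
- exact: induced_Inf.
Qed.
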